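(* Let $\lambda\in(0,1]$, $\rho\in[0,1)$ and suppose $\lim_{k\to\infty}\alpha_k/k=-(1-\lambda)/\lambda$ and $\lim_{m\to\infty}\beta_m/m=-\rho/(1-\rho)$. Then with probability 1, $$\lim_{|z|\to\infty,\;z\in\mathbb{Z}_+^2}\frac{G(z)-p(z)}{|z|}=0,$$ where $$p(z)=\begin{cases}(\sqrt{z(1)}+\sqrt{z(2)})^2,&\text{if }\left(\frac{\rho}{1-\rho}\right)^2\le\frac{z(2)}{z(1)}\le\left(\frac{\lambda}{1-\lambda}\right)^2,\\[4pt]\frac{z(1)}{1-\lambda}+\frac{z(2)}{\lambda},&\text{if }\frac{z(2)}{z(1)}\ge\max\left(\left(\frac{\lambda}{1-\lambda}\right)^2,\frac{\lambda\rho}{(1-\lambda)(1-\rho)}\right),\\[4pt]\frac{z(1)}{1-\rho}+\frac{z(2)}{\rho},&\text{if }\frac{z(2)}{z(1)}\le\min\left(\left(\frac{\rho}{1-\rho}\right)^2,\frac{\lambda\rho}{(1-\lambda)(1-\rho)}\right).\end{cases}$$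
   Context: Let $\{X(z):z\in\mathbb{Z}^2\}$ be i.i.d. exponential random variables with mean 1. Write $z=(z(1),z(2))$, $|z|=|z(1)|+|z(2)|$, order $\mathbb{Z}^2$ coordinatewise, and let $\mathbb{Z}_+=\{1,2,\dots\}$. A directed path is a sequence in $\mathbb{Z}^2$ with increments in $\{(0,1),(1,0)\}$. For $z\le z'$ let $T(z\to z')$ be the maximum, over directed paths $\pi$ from $z$ to $z'$, of $\sum_{y\in\pi}X(y)$. Let $0>\alpha_1\ge\alpha_2\ge\cdots$ and $0>\beta_1\ge\beta_2\ge\cdots$ be integer sequences, $A_k=(\alpha_k+1,k)$, $B_m=(m,\beta_m+1)$ for $k,m\ge1$. For $z\in\mathbb{Z}_+^2$, $$G(z)=\max\Big\{\max_{0<k\le z(2)}T(A_k\to z),\;\max_{0<m\le z(1)}T(B_m\to z)\Big\}.$$ Conventions: if $\lambda=1$ then $\lambda/(1-\lambda)=+\infty$ and the second case of the definition of $p$ is void; if $\rho=0$ the third case is void. *)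

(* Defs.v *)
From HB Require Import structures.
From mathcomp Require Import all_boot all_order all_algebra.
From mathcomp Require Import finmap.
From mathcomp Require Import all_classical all_reals all_analysis.

Set Implicit Arguments.
Unset Strict Implicit.
Unset Printing Implicit Defensive.

Import Order.TTheory GRing.Theory Num.Theory.
Import numFieldNormedType.Exports.

Local Open Scope classical_set_scope.
Local Open Scope ring_scope.

Definition mutually_independent d (T : measurableType d) (R : realType)
    (P : probability T R) (I : choiceType) (X : I -> {RV P >-> R}) : Prop :=
  forall (J : {fset I}) (B : I -> set R), (forall i, measurable (B i)) ->
    P (\bigcap_(i in [set` J]) X i @^-1` B i) =
    (\prod_(i <- J) P (X i @^-1` B i))%E.

Definition iid_exponential1 d (T : measurableType d) (R : realType)
    (P : probability T R) (I : choiceType) (X : I -> {RV P >-> R}) : Prop :=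
  mutually_independent X /\
  forall i (A : set R), measurable A ->
    distribution P (X i) A = exponential_prob (1 : R) A.

Definition up_right : rel (int * int) :=
  [rel x y | (y == (x.1 + 1, x.2)) || (y == (x.1, x.2 + 1))].

(* A path is given as its starting point [z] and the list [s] of its
   remaining vertices. *)
Definition directed_paths (z z' : int * int) : set (seq (int * int)) :=
  [set s | path up_right z s /\ last z s = z'].

(* For z <= z' the supremum is over a nonempty finite set, hence a maximum. *)
Definition lpp (R : realType) (x : int * int -> R) (z z' : int * int) : R :=
  sup [set \sum_(y <- z :: s) x y | s in directed_paths z z'].

(* Only the values of [alpha] and [beta] at indices k, m >= 1 are relevant. *)
Definition ptA (alpha : nat -> int) (k : nat) : int * int :=
  (alpha k + 1, k%:Z).

Definition ptB (beta : nat -> int) (m : nat) : int * int :=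
  (m%:Z, beta m + 1).

(* For z(1), z(2) >= 1 both suprema are over nonempty finite sets. *)
Definition lppG (R : realType) (alpha beta : nat -> int)
    (x : int * int -> R) (z : int * int) : R :=
  Num.max
    (sup [set lpp x (ptA alpha k) z | k in [set k | (0 < k)%N /\ k%:Z <= z.2]])
    (sup [set lpp x (ptB beta m) z | m in [set m | (0 < m)%N /\ m%:Z <= z.1]]).

(* lam / (1 - lam), equal to +oo at lam = 1. *)
Definition odds (R : realType) (lam : R) : \bar R :=
  if lam == 1 then +oo%E else (lam / (1 - lam))%:E.

(* The three regions cover the quadrant, with agreeing formulas on overlaps, so
   the order of the tests and the final default are immaterial.
   lam = 1 makes the second condition false since its threshold is +oo;
   rho = 0 makes the third one false since z(2)/z(1) > 0 (when moreover
   lam = 1, the product below is +oo * 0 = 0). *)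
Definition limit_shape (R : realType) (lam rho : R) (z : int * int) : R :=
  let z1 : R := z.1%:~R in
  let z2 : R := z.2%:~R in
  let r := (z2 / z1)%:E in
  let a := odds lam in
  let b := odds rho in
  if (b ^+ 2 <= r <= a ^+ 2)%E then (Num.sqrt z1 + Num.sqrt z2) ^+ 2
  else if (Order.max (a ^+ 2) (a * b) <= r)%E then z1 / (1 - lam) + z2 / lam
  else if (r <= Order.min (b ^+ 2) (a * b))%E then z1 / (1 - rho) + z2 / rho
  else 0.

Definition l1norm (z : int * int) : int := `|z.1| + `|z.2|.

(* |z| -> oo along z in {1, 2, ...}^2. *)
Definition quadrant_infty : set_system (int * int) :=
  filter_from [set: nat]
    (fun N => [set z | [/\ 0 < z.1, 0 < z.2 & N%:Z <= l1norm z]]).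

Lemma quadrant_infty_filter : ProperFilter quadrant_infty.
Proof.
apply: filter_from_proper.
  apply: filter_from_filter; first by exists 0%N.
  move=> i j _ _; exists (maxn i j) => // z [z1 z2 h].
  by split; split => //; apply: le_trans h; rewrite lez_nat ?leq_maxl ?leq_maxr.
move=> N _; exists (N.+1%:Z, 1); split => //=.
by rewrite /l1norm /= !ger0_norm// -PoszD lez_nat addn1 2?leqW.
Qed.

#[global] Existing Instance quadrant_infty_filter.

(* Main.v *)
(**
Fix rho in (0,1). If the weights on the two axes through a corner are replaced
by Exp(1 - rho) and Exp(rho) variables, last passage percolation becomes
stationary (Burke's property): its increments along any row are again
i.i.d. Exp(1 - rho), so its value at (m, n) concentrates around
m / (1 - rho) + n / rho. Optimizing over rho bounds the point-to-point passage
time by (sqrt m + sqrt n)^2. Conversely, at the optimal rho the stationary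
geodesic can only follow an axis for a short while, since otherwise the upper
bound just obtained would be violated; this gives the matching lower bound.
The problem for G is then deterministic: maximize
(sqrt (a + c k) + sqrt (b - k))^2 over k, where -c is the slope of the boundary.

Burke's property is proved after rounding down to a lattice. The weights are
then independent geometric variables, and processing one site is an involution
(I, J, w) -> (I - J + w, J - I + w, min (I, J)) (truncated subtractions) of the
configurations which preserves the probability of every single configuration.
Exponential tail bounds follow by comparing the probabilities of single
configurations for two choices of the rates, so no product measure is needed.
*)
Require Import Defs.
From HB Require Import structures.
From mathcomp Require Import all_boot all_order all_algebra.
From mathcomp Require Import finmap.
From mathcomp Require Import all_classical all_reals all_analysis.
From mathcomp Require Import zify ring lra.

Set Implicit Arguments.
Unset Strict Implicit.
Unset Printing Implicit Defensive.

Import Order.TTheory GRing.Theory Num.Theory.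
Import numFieldNormedType.Exports.

Local Open Scope classical_set_scope.
Local Open Scope ring_scope.

(** * Last passage percolation by recursion *)

(** The points [A_k] and [B_m] move away as [z] grows, so a limit for one fixed corner is not
    enough. At each scale [N], about [N^4] pairs (corner, extent) must obey the stationary law up to
    [eps * N]; this is why exponential tails and Borel-Cantelli are used. The mesh [1 / s] stays
    fixed once [eps] is, since rounding costs at most [(m + n) / s], which is of the tolerated
    order. The stationary value is the sum of the left column before processing and of the top row
    after it. Each is a sum of independent geometric variables; their dependence on each other is
    harmless because both are bounded separately. For all rates the axis weights are rescaled from
    the same field [X], so no probability space is enlarged and axis sums are themselves passage
    times. Countably many rates [i / M] suffice, because a nearby rate only costs a square. On the
    resulting almost sure event everything else is deterministic. *)

Definition site (u : int * int) (e : nat * nat) : int * int :=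
  (u.1 + e.1%:Z, u.2 + e.2%:Z).

Lemma siteD u e f : site (site u e) f = site u (e.1 + f.1, e.2 + f.2)%N.
Proof. by rewrite /site /= !PoszD !addrA. Qed.

Lemma site0 u : site u (0, 0)%N = u.
Proof. by rewrite /site /= !addr0 -surjective_pairing. Qed.

Lemma site_right u i j :
  ((site u (i, j)).1 + 1, (site u (i, j)).2) = site u (i.+1, j).
Proof. by rewrite /site /=; congr (_, _); lia. Qed.

Lemma site_up u i j :
  ((site u (i, j)).1, (site u (i, j)).2 + 1) = site u (i, j.+1).
Proof. by rewrite /site /=; congr (_, _); lia. Qed.

Section growth.
Variable R : realDomainType.
Implicit Types w v : nat * nat -> R.

(* The weight w (0, 0) is ignored: it is 0 for the stationary process, and is
   added separately for point-to-point passage times. *)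
Fixpoint growth w (i : nat) {struct i} : nat -> R :=
  match i with
  | 0 => fix col j := if j is j'.+1 then col j' + w (0, j)%N else 0
  | i'.+1 => fix col j :=
      if j is j'.+1 then Num.max (growth w i' j) (col j') + w (i, j)
      else growth w i' 0%N + w (i, 0)%N
  end.

Lemma growth00 w : growth w 0 0 = 0. Proof. by []. Qed.
Lemma growth0S w j : growth w 0 j.+1 = growth w 0 j + w (0, j.+1)%N.
Proof. by []. Qed.
Lemma growthS0 w i : growth w i.+1 0 = growth w i 0 + w (i.+1, 0)%N.
Proof. by []. Qed.
Lemma growthSS w i j : growth w i.+1 j.+1 =
  Num.max (growth w i j.+1) (growth w i.+1 j) + w (i.+1, j.+1).
Proof. by []. Qed.

Lemma growth_stepl w i j : growth w i j + w (i.+1, j) <= growth w i.+1 j.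
Proof.
case: j => [|j]; first by rewrite growthS0.
by rewrite growthSS lerD2r le_max lexx.
Qed.

Lemma growth_stepr w i j : growth w i j + w (i, j.+1) <= growth w i j.+1.
Proof.
case: i => [|i]; first by rewrite growth0S.
by rewrite growthSS lerD2r le_max lexx orbT.
Qed.

Lemma growth_ind (Q : nat -> nat -> Prop) :
  Q 0%N 0%N -> (forall j, Q 0%N j -> Q 0%N j.+1) ->
  (forall i, Q i 0%N -> Q i.+1 0%N) ->
  (forall i j, Q i j.+1 -> Q i.+1 j -> Q i.+1 j.+1) ->
  forall i j, Q i j.
Proof.
move=> Q00 Q0S QS0 QSS; elim=> [|i IHi].
  by elim=> // j; exact: Q0S.
elim=> [|j IHj]; first exact: QS0 (IHi 0%N).
exact: QSS.
Qed.

Lemma eq_growth w v i j : w =1 v -> growth w i j = growth v i j.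
Proof.
move=> wv; elim/growth_ind: i / j => // [j|i|i j].
- by rewrite !growth0S wv => ->.
- by rewrite !growthS0 wv => ->.
- by rewrite !growthSS wv => -> ->.
Qed.

(** At most one weight enters per step, [i + j] in all. With [d = 0] this is monotonicity in the
    weights; with [d = s^-1] it is the cost of rounding. *)
Lemma le_growth w v d i j : (forall e, w e <= v e + d) ->
  growth w i j <= growth v i j + d *+ (i + j).
Proof.
move=> wv; elim/growth_ind: i / j => [|j|i|i j].
- by rewrite addr0.
- by move=> IH; rewrite !growth0S addnS mulrSr addrACA lerD.
- by move=> IH; rewrite !growthS0 addSn mulrSr addrACA lerD.
- move=> IH1; rewrite addSnnS => IH2; rewrite !growthSS addSn mulrSr.
  rewrite addrACA lerD//.
  by rewrite addr_maxl ge_max !le_max IH1 IH2 orbT.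
Qed.

(** Concatenation of paths: the second piece ignores the weight at its origin, which is the endpoint
    of the first, so no site counts twice. *)
Lemma growth_super w k l i j : growth w k l +
    growth (fun e => w (k + e.1, l + e.2)%N) i j <= growth w (k + i) (l + j).
Proof.
set v := (X in growth X i j).
elim/growth_ind: i / j => [|j|i|i j].
- by rewrite !addn0 addr0.
- rewrite growth0S addnS => /(lerD (lexx (v (0, j.+1)%N))) IH.
  apply: le_trans (growth_stepr _ _ _).
  by move: IH; rewrite /v /= addnS; lra.
- rewrite growthS0 addnS => /(lerD (lexx (v (i.+1, 0)%N))) IH.
  apply: le_trans (growth_stepl _ _ _).
  by move: IH; rewrite /v /= addnS; lra.
- rewrite growthSS !addnS growthSS => IH1 IH2.
  rewrite addrA lerD//; last by rewrite /v /= !addnS.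
  by rewrite addr_maxr ge_max !le_max IH1 IH2 orbT.
Qed.

Lemma growth_ge0 w i j : (forall e, 0 <= w e) -> 0 <= growth w i j.
Proof.
move=> w0; elim/growth_ind: i / j => // [j|i|i j].
- by rewrite growth0S => ?; rewrite addr_ge0.
- by rewrite growthS0 => ?; rewrite addr_ge0.
- by rewrite growthSS => ? ?; rewrite addr_ge0// le_max; apply/orP; left.
Qed.

(* A geodesic to the bulk leaves the axes at (k + 1, 0) or at (0, l + 1). *)
Lemma growth_exit w m n :
  (exists2 k, (k <= m)%N & growth w m.+1 n.+1 <=
    growth w k.+1 0 + w (k.+1, 1)%N +
    growth (fun e => w (k.+1 + e.1, 1 + e.2)%N) (m - k) n) \/
  (exists2 l, (l <= n)%N & growth w m.+1 n.+1 <=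
    growth w 0 l.+1 + w (1, l.+1)%N +
    growth (fun e => w (1 + e.1, l.+1 + e.2)%N) m (n - l)).
Proof.
have stepl k l i j : growth (fun e => w (k + e.1, l + e.2)%N) i j +
    w (k + i.+1, l + j)%N <= growth (fun e => w (k + e.1, l + e.2)%N) i.+1 j.
  by have := growth_stepl (fun e => w (k + e.1, l + e.2)%N) i j.
have stepr k l i j : growth (fun e => w (k + e.1, l + e.2)%N) i j +
    w (k + i, l + j.+1)%N <= growth (fun e => w (k + e.1, l + e.2)%N) i j.+1.
  by have := growth_stepr (fun e => w (k + e.1, l + e.2)%N) i j.
have [s] := ubnP (m + n); elim: s m n => // s IH m n mns.
(* The geodesic is followed backwards through the larger predecessor until that predecessor lies on
   an axis. *)
rewrite growthSS; have [le1|le2] := leP (growth w m.+1 n) (growth w m n.+1).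
  case: m => [|m] in mns le1 *.
    by right; exists n => //; rewrite subnn growth00 addr0.
  have {IH} [|[k km IH]|[l ln IH]] := IH m n; first by lia.
    left; exists k; first lia.
    have := stepl k.+1 1%N (m - k)%N n; rewrite subSn//.
    by rewrite (_ : (k.+1 + (m - k).+1 = m.+2)%N); [|lia]; rewrite add1n; lra.
  right; exists l => //.
  have := stepl 1%N l.+1 m (n - l)%N.
  by rewrite (_ : (l.+1 + (n - l) = n.+1)%N); [|lia]; rewrite add1n; lra.
case: n => [|n] in mns le2 *.
  by left; exists m => //; rewrite subnn growth00 addr0.
have {IH} [|[k km IH]|[l ln IH]] := IH m n; first by lia.
  left; exists k => //.
  have := stepr k.+1 1%N (m - k)%N n.
  by rewrite (_ : (k.+1 + (m - k) = m.+1)%N); [|lia]; rewrite add1n; lra.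
right; exists l; first lia.
have := stepr 1%N l.+1 m (n - l)%N; rewrite subSn//.
by rewrite (_ : (l.+1 + (n - l).+1 = n.+2)%N); [|lia]; rewrite add1n; lra.
Qed.

End growth.

(** * Passage times over paths as values of the recursion *)

Section last_passage.
Variable R : realType.
Implicit Types x : int * int -> R.

Lemma directed_path_le x z s : path up_right z s -> exists e,
  last z s = site z e /\
  \sum_(y <- s) x y <= growth (fun e => x (site z e)) e.1 e.2.
Proof.
elim/last_ind: s => [_|s y IH].
  by exists (0, 0)%N; rewrite big_nil site0.
rewrite rcons_path => /andP[/IH[[i j] [/= -> le_ij]]] /orP[]/eqP ->.
  rewrite site_right; exists (i.+1, j); rewrite last_rcons big_rcons.
  by split=> //; apply: le_trans (growth_stepl _ _ _); rewrite /= lerD.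
rewrite site_up; exists (i, j.+1); rewrite last_rcons big_rcons.
by split=> //; apply: le_trans (growth_stepr _ _ _); rewrite /= lerD.
Qed.

Lemma directed_path_max x z i j : exists s,
  directed_paths z (site z (i, j)) s /\
  \sum_(y <- s) x y = growth (fun e => x (site z e)) i j.
Proof.
have ext s (e f : nat * nat) : path up_right z s -> last z s = site z e ->
    up_right (site z e) (site z f) ->
    directed_paths z (site z f) (rcons s (site z f)).
  by move=> zs ls ef; split; rewrite ?last_rcons// rcons_path zs ls.
have rt a b : up_right (site z (a, b)) (site z (a.+1, b)).
  by apply/orP; left; rewrite site_right.
have up a b : up_right (site z (a, b)) (site z (a, b.+1)).
  by apply/orP; right; rewrite site_up.
elim/growth_ind: i / j.
- by exists [::]; rewrite big_nil; split => //; split; rewrite ?site0.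
- move=> j [s [[zs ls] sE]]; exists (rcons s (site z (0, j.+1)%N)); split.
    exact: ext ls (up _ _).
  by rewrite big_rcons growth0S -sE.
- move=> i [s [[zs ls] sE]]; exists (rcons s (site z (i.+1, 0)%N)); split.
    exact: ext ls (rt _ _).
  by rewrite big_rcons growthS0 -sE.
- move=> i j [s [[zs ls] sE]] [t [[zt lt] tE]]; rewrite growthSS.
  case: leP => _.
    exists (rcons t (site z (i.+1, j.+1))); split; first exact: ext lt (up _ _).
    by rewrite big_rcons -tE.
  exists (rcons s (site z (i.+1, j.+1))); split; first exact: ext ls (rt _ _).
  by rewrite big_rcons -sE.
Qed.

Lemma lpp_growth x z i j : lpp x z (site z (i, j)) =
  x z + growth (fun e => x (site z e)) i j.
Proof.
have ub : ubound [set \sum_(y <- z :: s) x y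
    | s in directed_paths z (site z (i, j))]
    (x z + growth (fun e => x (site z e)) i j).
  move=> _ /= [s [zs ls] <-]; rewrite big_cons lerD2l.
  have [[i' j'] [l le_s]] := directed_path_le x zs.
  apply: le_trans le_s _; suff [-> ->] : i' = i /\ j' = j by [].
  by move: l; rewrite ls /site => -[/= ? ?]; split; lia.
apply/eqP; rewrite eq_le; apply/andP; split.
  apply: ge_sup ub.
  by have [s [? _]] := directed_path_max x z i j; eexists; exists s.
apply: ub_le_sup; first by eexists; exact: ub.
have [s [? sE]] := directed_path_max x z i j; exists s => //.
by rewrite big_cons sE.
Qed.

End last_passage.

(** * Burke's property for configurations *)

Section flip.
Implicit Types (y : nat * nat -> nat) (S : seq (nat * nat)).

(* At site c = (i, j), the entries (i, 0) and (0, j) of the configuration hold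
   the increments below and to the left of the site and become those above and
   to the right; the entry c holds the weight and becomes the dual weight. *)
Definition flip (c : nat * nat) y : nat * nat -> nat := fun e =>
  if e == (c.1, 0)%N then (y (c.1, 0) - y (0, c.2) + y c)%N
  else if e == (0, c.2)%N then (y (0, c.2) - y (c.1, 0) + y c)%N
  else if e == c then minn (y (c.1, 0)%N) (y (0, c.2)%N)
  else y e.

(** One of the two truncated differences vanishes, so the minimum of the new increments is [w],
    while [I - J] and [J - I] are unchanged; applying the map again adds [min (I, J)] back. *)
Lemma flipK i j : involutive (flip (i.+1, j.+1)).
Proof.
move=> y; apply/funext => e; rewrite /flip /= !xpair_eqE /= !eqxx /=.
case: eqP => [->|_] /=; first lia.
case: eqP => [->|_] /=; first lia.
by case: eqP => [->|_] //; lia.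
Qed.

Lemma flip_id (c e : nat * nat) y : e != (c.1, 0)%N -> e != (0, c.2)%N -> e != c ->
  flip c y e = y e.
Proof. by rewrite /flip => /negPf -> /negPf -> /negPf ->. Qed.

(** Writing [I = (I - J) + min (I, J)], and [J] likewise, makes both sides symmetric in [w] and
    [min (I, J)], provided the coefficient at the site is the sum of the two others. The logarithm
    of the probability of a configuration is such a sum. *)
Lemma sum_flip (R : realDomainType) (k : nat * nat -> R) i j S y :
  uniq S -> {subset [:: (i.+1, 0); (0, j.+1); (i.+1, j.+1)]%N <= S} ->
  k (i.+1, 0)%N + k (0, j.+1)%N = k (i.+1, j.+1) ->
  \sum_(e <- S) k e * (flip (i.+1, j.+1) y e)%:R = \sum_(e <- S) k e * (y e)%:R.
Proof.
set s := [:: _; _; _] => uS sS kD.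
have us : uniq s by rewrite /s /= !inE !xpair_eqE /= andbF.
have /(perm_big _) E : perm_eq S (s ++ [seq x <- S | predC (mem s) x]).
  rewrite -(perm_filterC (mem s) S) perm_cat2r.
  apply: uniq_perm; rewrite ?filter_uniq// => e.
  rewrite mem_filter andbC; case: (boolP (e \in S)) => // /negP eS.
  by apply/esym/negP => /sS.
rewrite !E !big_cat /=; congr (_ + _); last first.
  rewrite !big_filter; apply: eq_bigr => e.
  by rewrite !inE !negb_or => /and3P[? ? ?]; rewrite flip_id.
rewrite !big_cons !big_nil -kD /flip /= !xpair_eqE /= !eqxx /=.
set a := y (i.+1, 0)%N; set b := y (0, j.+1)%N; set w := y (i.+1, j.+1).
rewrite !natrD; case: (leqP a b) => ab.
  by rewrite (_ : (a - b = 0)%N) ?natrB//; [ring|lia].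
by rewrite (_ : (b - a = 0)%N) ?natrB ?(ltnW ab)//; [ring|lia].
Qed.

Fixpoint flip_row j y i := 
  if i is i'.+1 then flip (i'.+1, j) (flip_row j y i') else y.

Fixpoint flip_rows y m n :=
  if n is n'.+1 then flip_row n'.+1 (flip_rows y m n') m else y.

Section increments.
Variables (R : realDomainType) (y0 : nat * nat -> nat).
Let g : nat -> nat -> R := growth (fun e => (y0 e)%:R).

(** With [I] and [J] the increments below and to the left, the new value is the old corner plus
    [max (I, J) + w]. Subtracting [J] or [I] leaves exactly the truncated differences of [flip]. The
    last clause records the entries not reached yet. *)
Lemma flip_row_increments m j y :
  (forall i, (i < m)%N -> g i.+1 j = g i j + (y (i.+1, 0)%N)%:R) ->
  (forall e, (j < e.2)%N -> y e = y0 e) ->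
  forall i, (i <= m)%N -> let z := flip_row j.+1 y i in
  [/\ g i j.+1 = g i j + (z (0, j.+1)%N)%:R,
      forall a, (a < i)%N -> g a.+1 j.+1 = g a j.+1 + (z (a.+1, 0)%N)%:R &
      forall e, [|| (e.2 == 0) && (i < e.1), j.+1 < e.2 |
        (e.2 == j.+1) && (i < e.1)]%N -> z e = y e].
Proof.
move=> yg yy0; elim=> [_|i IH im] /=.
  by split=> //; rewrite yy0//= /g growth0S.
have [IH1 IH2 IH3] := IH (ltnW im).
set z := flip_row j.+1 y i in IH1 IH2 IH3 *.
have zi : z (i.+1, 0)%N = y (i.+1, 0)%N by rewrite IH3//= ltnSn.
have zc : z (i.+1, j.+1) = y0 (i.+1, j.+1).
  by rewrite IH3 ?yy0//= eqxx ltnSn !orbT.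
have gg : g i.+1 j.+1 = Num.max (g i j.+1) (g i.+1 j) + (y0 (i.+1, j.+1))%:R.
  by [].
split.
- rewrite /flip /= xpair_eqE /= eqxx /= zi zc gg IH1 yg// natrD.
  case: (leqP (z (0, j.+1)%N) (y (i.+1, 0)%N)) => h.
    rewrite max_r ?lerD2l ?ler_nat//.
    by move: h; rewrite -subn_eq0 => /eqP->; ring.
  by rewrite max_l ?lerD2l ?ler_nat 1?ltnW// natrB 1?ltnW//; ring.
- move=> a; rewrite ltnS leq_eqVlt => /orP[/eqP->|ai]; last first.
    by rewrite flip_id ?IH2// !xpair_eqE ?eqSS ?(ltn_eqF ai).
  rewrite /flip /= eqxx zi zc gg IH1 yg// natrD.
  case: (leqP (z (0, j.+1)%N) (y (i.+1, 0)%N)) => h.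
    by rewrite max_r ?lerD2l ?ler_nat// natrB//; ring.
  rewrite max_l ?lerD2l ?ler_nat 1?ltnW//.
  by move: (ltnW h); rewrite -subn_eq0 => /eqP->; ring.
- move=> [a b] /= h; rewrite flip_id; first by apply: IH3 => /=; lia.
  all: by rewrite xpair_eqE /=; lia.
Qed.

Lemma flip_rows_increments m n :
  (forall i, (i < m)%N -> g i.+1 n = g i n + (flip_rows y0 m n (i.+1, 0)%N)%:R) /\
  (forall e, (n < e.2)%N -> flip_rows y0 m n e = y0 e).
Proof.
elim: n => [|n [IH1 IH2]] /=; first by split.
have [_ h1 h2] := flip_row_increments IH1 IH2 (leqnn m).
split=> [i im|e ne]; first exact: h1.
by rewrite h2 ?IH2 ?(ltnW ne)// ne orbT.
Qed.

(** The path goes up the left column and then along row [n]. Concentration of the growth process is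
    thereby reduced to sums of independent variables. *)
Lemma growth_flip_rows m n : g m n = \sum_(j < n) (y0 (0, j.+1)%N)%:R +
  \sum_(i < m) (flip_rows y0 m n (i.+1, 0)%N)%:R.
Proof.
have -> : \sum_(j < n) (y0 (0, j.+1)%N)%:R = g 0 n.
  by elim: n => [|n IH]; rewrite ?big_ord0// big_ord_recr IH.
have [h _] := flip_rows_increments m n.
suff H i : (i <= m)%N ->
    g i n = g 0 n + \sum_(a < i) (flip_rows y0 m n (a.+1, 0)%N)%:R by exact: H.
elim: i => [|i IH] im; first by rewrite big_ord0 addr0.
by rewrite big_ord_recr /= h// IH 1?ltnW// addrA.
Qed.

End increments.
End flip.

(** * Independent geometric variables *)

Section geometric_law.
Context d (Omega : measurableType d) (R : realType) (P : probability Omega R).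
Implicit Types (V W : Omega -> nat * nat -> nat) (k : nat * nat -> R)
  (y : nat * nat -> nat) (S : seq (nat * nat)).

(* Sum the atoms: C times the mass under W is at most C. *)
Lemma le_countable_law (K : countType) (V W : Omega -> K) (B : pred K) (C : R) :
  (forall x, measurable (V @^-1` [set x])) ->
  (forall x, measurable (W @^-1` [set x])) -> 0 <= C ->
  (forall x, B x ->
    (P (V @^-1` [set x]) <= C%:E * P (W @^-1` [set x]))%E) ->
  measurable [set w | B (V w)] /\ (P [set w | B (V w)] <= C%:E)%E.
Proof.
move=> mV mW C0 VW.
pose F (Z : Omega -> K) n := if pickle_inv n is Some x then
  (if B x then Z @^-1` [set x] else set0) else set0.
have mF Z : (forall x, measurable (Z @^-1` [set x])) ->
    forall n, measurable (F Z n).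
  by move=> mZ n; rewrite /F; case: pickle_inv => // x; case: ifP.
have UF Z : [set w | B (Z w)] = \bigcup_n F Z n.
  apply/seteqP; split => w /=.
    by move=> Bw; exists (choice.pickle (Z w)) => //; rewrite /F pickleK_inv Bw.
  by move=> [n _]; rewrite /F; case: pickle_inv => // x; case: ifP => // Bx /= ->.
have tF Z : trivIset setT (F Z).
  have FE n w : F Z n w -> n = choice.pickle (Z w).
    rewrite /F; case E : pickle_inv => [x|//]; case: ifP => // _ /= ->.
    by have := @pickle_invK K n; rewrite /= /oapp E.
  by move=> i j _ _ [w [/FE -> /FE ->]].
have PE Z : (forall x, measurable (Z @^-1` [set x])) ->
    P [set w | B (Z w)] = (\sum_(n <oo) P (F Z n))%E.
  move=> mZ; rewrite UF; apply: measure_semi_bigcup => //.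
  - exact: mF.
  - by rewrite -UF UF; apply: bigcupT_measurable; exact: mF.
split; first by rewrite UF; apply: bigcupT_measurable; exact: mF.
rewrite PE//; apply: (@le_trans _ _ (\sum_(n <oo) C%:E * P (F W n))%E).
  apply: lee_nneseries => // n _; rewrite /F; case: pickle_inv => [x|].
    by case: ifP => [/VW//|_]; rewrite !measure0 mule0.
  by rewrite !measure0 mule0.
rewrite nneseriesZl// -PE//.
rewrite -[leRHS]mule1; apply: lee_wpmul2l; first by rewrite lee_fin.
by apply: probability_le1; rewrite UF; apply: bigcupT_measurable; exact: mF.
Qed.

Definition atom V S y : set Omega := [set w | forall e, e \in S -> V w e = y e].

(* On S the variables V e are independent geometric of parameter expR (- k e). *)
Definition geometric_law V k S : Prop := forall y, measurable (atom V S y) /\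
  P (atom V S y) = (\prod_(e <- S) (1 - expR (- k e)) *
                    expR (- \sum_(e <- S) k e * (y e)%:R))%:E.

(** [flip] is an involution that reads and writes only inside [S], so the preimage of an atom is an
    atom, and [sum_flip] says that it has the same mass. *)
Lemma flip_law V k S i j : uniq S ->
  {subset [:: (i.+1, 0); (0, j.+1); (i.+1, j.+1)]%N <= S} ->
  k (i.+1, 0)%N + k (0, j.+1)%N = k (i.+1, j.+1) ->
  geometric_law V k S ->
  geometric_law (fun w => flip (i.+1, j.+1) (V w)) k S.
Proof.
move=> uS sS kD lawV y; rewrite -(sum_flip y uS sS kD).
suff -> : atom (fun w => flip (i.+1, j.+1) (V w)) S y =
  atom V S (flip (i.+1, j.+1) y) by exact: lawV.
have flipS u v : (forall e, e \in S -> u e = v e) ->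
    forall e, e \in S -> flip (i.+1, j.+1) u e = flip (i.+1, j.+1) v e.
  by move=> uv e eS; rewrite /flip /= !uv//; apply: sS; rewrite !inE eqxx ?orbT.
by apply/seteqP; split => w /= /flipS; rewrite flipK.
Qed.

Definition box m n : seq (nat * nat) :=
  [seq (i, j) | i <- iota 0 m, j <- iota 0 n].

Lemma mem_box m n e : (e \in box m n) = (e.1 < m)%N && (e.2 < n)%N.
Proof.
apply/allpairsP/idP => [[[a b] /= [+ + ->]]|/andP[? ?]].
  by rewrite !mem_iota /= !add0n => -> ->.
by exists e; rewrite !mem_iota !add0n -surjective_pairing.
Qed.

Lemma uniq_box m n : uniq (box m n).
Proof. by apply: allpairs_uniq; rewrite ?iota_uniq// => -[? ?] [? ?]. Qed.

Lemma flip_rows_law V k m n :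
  (forall i j, k (i.+1, 0)%N + k (0, j.+1)%N = k (i.+1, j.+1)) ->
  geometric_law V k (box m.+1 n.+1) ->
  geometric_law (fun w => flip_rows (V w) m n) k (box m.+1 n.+1).
Proof.
move=> kD lawV; set S := box m.+1 n.+1.
suff H j : (j <= n)%N -> geometric_law (fun w => flip_rows (V w) m j) k S.
  exact: H.
elim: j => [_|j IHj jn]; first exact: lawV.
suff H i : (i <= m)%N ->
    geometric_law (fun w => flip_row j.+1 (flip_rows (V w) m j) i) k S.
  exact: H.
elim: i => [_|i IHi im]; first exact: IHj (ltnW jn).
apply: flip_law (IHi (ltnW im)) => //; first exact: uniq_box.
by move=> e; rewrite /S mem_box !inE => /or3P[]/eqP-> /=; lia.
Qed.

(* Exponential tilting: W has rate (1 + del) * r instead of r on D. *)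
Lemma geometric_law_tail V W k S (D : pred (nat * nat)) (r del t : R) :
  uniq S -> 0 < r -> 0 < 1 + del ->
  (forall e, 0 < k e) -> (forall e, e \in S -> D e -> k e = r) ->
  geometric_law V k S ->
  geometric_law W (fun e => if D e then (1 + del) * r else k e) S ->
  let A := [set w | del * \sum_(e <- S | D e) (V w e)%:R <= del * t] in
  measurable A /\
  (P A <= (((1 - expR (- r)) / (1 - expR (- ((1 + del) * r)))) ^+ count D S *
           expR (r * (del * t)))%:E)%E.
Proof.
move=> uS r0 del1 k0 kr lawV lawW.
(* Restricted to [S] and listed, configurations form a countable type, as [le_countable_law]
   requires. *)
pose rest V w : seq nat := [seq V w e | e <- S].
have restE Z l : rest Z @^-1` [set l] =
    if size l == size S then atom Z S (fun e => nth 0%N l (index e S)) else set0.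
  apply/seteqP; split => w /=.
    move=> <-; rewrite size_map eqxx => e eS.
    by rewrite (nth_map (0, 0)%N) ?index_mem// nth_index.
  case: ifP => // /eqP ls h; apply: (@eq_from_nth _ 0%N).
    by rewrite size_map ls.
  move=> i; rewrite size_map => iS.
  by rewrite (nth_map (0, 0)%N)// h ?mem_nth// index_uniq.
pose sumD (l : seq nat) : R := \sum_(e <- S | D e) (nth 0%N l (index e S))%:R.
(* Keeping [del] on both sides covers both tails: a positive [del] gives the lower one, a negative
   [del] the upper one. *)
pose B : pred (seq nat) := fun l => del * sumD l <= del * t.
have -> : [set w | del * \sum_(e <- S | D e) (V w e)%:R <= del * t] =
    [set w | B (rest V w)].
  rewrite /B /sumD /rest; apply/seteqP; split => w /=;
  congr (_ * _ <= _); rewrite big_seq_cond [RHS]big_seq_cond;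
  apply: eq_bigr => e /andP[eS _];
  by rewrite (nth_map (0, 0)%N) ?index_mem// nth_index.
have mrest Z k' : geometric_law Z k' S ->
    forall l, measurable (rest Z @^-1` [set l]).
  move=> lawZ l; rewrite restE; case: ifP => // _.
  by case: (lawZ (fun e => nth 0%N l (index e S))).
have ratio_ge0 : 0 <= (1 - expR (- r)) / (1 - expR (- ((1 + del) * r))).
  by rewrite divr_ge0// subr_ge0 expR_le1 oppr_le0 ltW// mulr_gt0.
apply: (le_countable_law (mrest _ _ lawV) (mrest _ _ lawW)).
  by rewrite mulr_ge0 ?exprn_ge0// expR_ge0.
move=> l Bl; rewrite !restE; case: ifP => _; last by rewrite measure0 mule0.
set y := fun e => nth 0%N l (index e S).
have [_ ->] := lawV y; have [_ ->] := lawW y.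
rewrite -EFinM lee_fin.
set k' := fun e => if D e then (1 + del) * r else k e.
(* The likelihood ratio at one configuration: the normalizing factors give the power, [sumE] gives
   the exponent, and membership in [B] bounds that exponent. *)
have prodE : \prod_(e <- S) (1 - expR (- k e)) =
    ((1 - expR (- r)) / (1 - expR (- ((1 + del) * r)))) ^+ count D S *
    \prod_(e <- S) (1 - expR (- k' e)).
  rewrite -iter_mulr_1 -big_const_seq [X in X * _]big_mkcond -big_split.
  rewrite big_seq [RHS]big_seq; apply: eq_bigr => e eS.
  rewrite /k' /=; case: ifP => [De|_]; last by rewrite mul1r.
  rewrite (kr _ eS De) divfK// subr_eq0 eq_sym lt_eqF//.
  by rewrite expR_lt1 oppr_lt0 mulr_gt0.
have sumE : \sum_(e <- S) k' e * (y e)%:R =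
    \sum_(e <- S) k e * (y e)%:R + r * (del * sumD l).
  rewrite /sumD [X in r * (del * X)]big_mkcond !mulr_sumr -big_split.
  rewrite big_seq [RHS]big_seq; apply: eq_bigr => e eS.
  rewrite /k' /y; case: ifP => [De|_]; last by rewrite /= !mulr0 addr0.
  by rewrite (kr _ eS De) /=; ring.
rewrite prodE -!mulrA ler_wpM2l ?exprn_ge0// [leRHS]mulrCA ler_wpM2l//.
  apply: prodr_ge0 => e _; rewrite subr_ge0 expR_le1 oppr_le0 /k'.
  by case: ifP => _; rewrite ltW// mulr_gt0.
rewrite -expRD ler_expR sumE.
by have := ler_wpM2l (ltW r0) Bl; lra.
Qed.

End geometric_law.

(** * Rounding exponential variables *)

Section exponential_cells.
Variable R : realType.
Implicit Types (k a b : R) (n : nat).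

(** Truncation sends negative reals to 0, so the cell of 0 is a half-line; the exponential law does
    not charge the extra part. *)
Lemma truncn_cellE k n : 0 < k -> [set x : R | Num.truncn (x / k) = n] =
  if n == 0 then `]-oo, k[%classic else `[n%:R * k, n.+1%:R * k[%classic.
Proof.
move=> k0; apply/seteqP; split => x /=; case: (eqVneq n 0) => [->|n0] /=.
- by move=> /truncn0Pn; rewrite -ltNge ltr_pdivrMr// mul1r in_itv.
- move=> E; have x1 : 1 <= x / k by rewrite -truncn_gt0 E lt0n.
  have := truncn_itv (le_trans ler01 x1).
  by rewrite E ler_pdivlMr// ltr_pdivrMr// in_itv.
- by rewrite in_itv /= => xk; apply/truncn0Pn; rewrite -ltNge ltr_pdivrMr// mul1r.
- by rewrite in_itv /= -ler_pdivlMr// -ltr_pdivrMr//; exact: truncn_def.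
Qed.

Lemma measurable_truncn_cell k n : 0 < k ->
  measurable [set x : R | Num.truncn (x / k) = n].
Proof. by move=> k0; rewrite truncn_cellE//; case: ifP. Qed.

Lemma exponential_prob_nneg (A : set R) : measurable A ->
  exponential_prob 1 A = exponential_prob 1 (A `&` `[0, +oo[).
Proof.
move=> mA; rewrite /exponential_prob integral_mkcondr.
apply: eq_integral => x _; rewrite /exponential_pdf /= !patchE.
by case: ifP.
Qed.

Lemma exponential_prob_itvco a b : 0 <= a -> a < b ->
  exponential_prob 1 `[a, b[ = (expR (- a) - expR (- b))%:E.
Proof.
move=> a0 ab; rewrite /exponential_prob integral_itv_bndo_bndc; last first.
  apply/measurable_realfun.measurable_EFinP/measurable_funTS.
  exact: measurable_exponential_pdf.
have cE : continuous (fun z : R => - expR (- 1 * z) : R).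
  move=> z; apply: cvgN; apply: continuous_comp; last exact: continuous_expR.
  exact: mulrl_continuous.
rewrite (@continuous_FTC2 _ _ (fun x => - expR (- 1 * x)))//.
- by rewrite -EFinB !mulN1r; congr (_%:E); ring.
- apply: (@continuous_subspaceW R^o _ _ [set` `[0, +oo[%R]).
    by move=> x /=; rewrite !in_itv /= andbT => /andP[/(le_trans a0)].
  exact: within_continuous_exponential_pdf.
- split; [by move=> z _; exact: ex_derive| |].
  + by apply/cvg_at_right_filter; exact: cE.
  + by apply/cvg_at_left_filter; exact: cE.
- move=> z; rewrite in_itv /= => /andP[az _].
  by apply: derive1_exponential_pdf; rewrite in_itv /= andbT (le_lt_trans a0).
Qed.

Lemma exponential_prob_cell k n : 0 < k ->
  exponential_prob 1 [set x | Num.truncn (x / k) = n] =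
  ((1 - expR (- k)) * expR (- (k * n%:R)))%:E.
Proof.
move=> k0; rewrite exponential_prob_nneg; last exact: measurable_truncn_cell.
have -> : [set x : R | Num.truncn (x / k) = n] `&` `[0, +oo[ =
    `[n%:R * k, n.+1%:R * k[%classic.
  rewrite truncn_cellE//; case: eqVneq => [->|n0].
    rewrite mul0r mul1r; apply/seteqP; split => x /=; rewrite !in_itv /= andbT.
      by case=> -> ->.
    by case/andP.
  apply/setIidl => x /=; rewrite !in_itv /= andbT => /andP[+ _].
  by apply: le_trans; rewrite mulr_ge0// ltW.
rewrite exponential_prob_itvco ?mulr_ge0// 1?ltW//.
  congr (_%:E); rewrite mulrBl mul1r -expRD; congr (expR _ - expR _).
    by rewrite mulrC.
  by rewrite mulrSr; ring.
by rewrite ltr_pM2r// ltr_nat.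
Qed.

End exponential_cells.

Section iid.
Context d (Omega : measurableType d) (R : realType) (P : probability Omega R).
Variable X : (int * int)%type -> {RV P >-> R}.
Hypothesis iidX : iid_exponential1 X.

Lemma ae_exponential_ge0 : {ae P, forall w, forall z, 0 <= X z w}.
Proof.
suff H (p : nat) : {ae P, forall w,
    if choice.unpickle p is Some z then 0 <= X (z : int * int) w else true}.
  have := ae_foralln H; apply: filterS => w /= h z.
  by have := h (choice.pickle z); rewrite choice.pickleK.
case: choice.unpickle => [z|]; last exact: nearW.
have mA : measurable (X z @^-1` `]-oo, 0[).
  exact: measurable_funPTI.
exists (X z @^-1` `]-oo, 0[); split => //.
  rewrite -[LHS]/(distribution P (X z) `]-oo, 0[%classic) iidX.2//.
  rewrite exponential_prob_nneg// (_ : _ `&` _ = set0).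
    by rewrite /exponential_prob integral_set0.
  rewrite -subset0 => x /=; rewrite !in_itv /= andbT => -[].
  by move=> /lt_le_trans h /h; rewrite ltxx.
by move=> w /= /negP; rewrite -ltNge in_itv.
Qed.

(** The unit [k e] is free at every site. Changing it realizes the axis rates, and also the tilted
    reference laws, from the same field [X]. *)
Lemma truncn_law (k : nat * nat -> R) u S : (forall e, 0 < k e) -> uniq S ->
  geometric_law P (fun w e => Num.truncn (X (site u e) w / k e)) k S.
Proof.
move=> k0 uS y.
(* Independence takes a family of events indexed by the whole lattice, so the cells are transported
   by a total left inverse of [site u]. *)
pose unsite (z : int * int) := (absz (z.1 - u.1), absz (z.2 - u.2)).
have siteK : cancel (site u) unsite.
  by move=> [a b]; rewrite /unsite /site /= ![_ + _ - _]addrAC !subrr !add0r.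
pose B z : set R := [set r | Num.truncn (r / k (unsite z)) = y (unsite z)].
pose J := seq_fset tt [seq site u e | e <- S].
have mB z : measurable (B z) by exact: measurable_truncn_cell.
have E : atom (fun w e => Num.truncn (X (site u e) w / k e)) S y =
    \bigcap_(z in [set` J]) X z @^-1` B z.
  apply/seteqP; split => w /=.
    move=> h z /=; rewrite seq_fsetE => /mapP[e eS ->].
    by rewrite /B /= siteK h.
  move=> h e eS; have /= := h (site u e).
  by rewrite /B /= siteK; apply; rewrite seq_fsetE map_f.
have usS : uniq [seq site u e | e <- S].
  by rewrite map_inj_uniq//; exact: can_inj siteK.
split.
  rewrite E; apply: fin_bigcap_measurable => // z _.
  exact: measurable_funPTI.
rewrite E iidX.1//.
rewrite (perm_big _ (seq_fset_perm _ _)) /= undup_id// big_map.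
rewrite -sumrN expR_sum -big_split /= -prodEFin; apply: eq_bigr => e _.
rewrite -[LHS]/(distribution P (X (site u e)) (B (site u e))) iidX.2//.
by rewrite /B siteK exponential_prob_cell.
Qed.

End iid.

(** * Tail estimates *)

Section tails.
Variable R : realType.

(** With [q = (1 + del) * r] the ratio is at most [(1 + q) / (1 + del)]. The factor [1 + q] costs
    [2 * r], the price of the lattice, and [1 / (1 + del) <= 1 - del + 2 * del ^+ 2]. *)
Lemma geometric_ratio_le (r del : R) : 0 < r -> `|del| <= 2^-1 ->
  (1 - expR (- r)) / (1 - expR (- ((1 + del) * r))) <=
  expR (2 * r - del + 2 * del ^+ 2).
Proof.
move=> r0 /ler_normlP[d1 d2].
set q := (1 + del) * r.
have del0 : 0 < 1 + del by lra.
have q0 : 0 < q by rewrite mulr_gt0.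
have q2 : q <= 2 * r by rewrite ler_pM2r//; lra.
have num : 1 - expR (- r) <= r by have := expR_ge1Dx (- r); lra.
have den : q / (1 + q) <= 1 - expR (- q).
  have : expR (- q) <= (1 + q)^-1.
    by rewrite expRN lef_pV2 ?posrE ?expR_gt0 ?expR_ge1Dx// addr_gt0.
  suff -> : q / (1 + q) = 1 - (1 + q)^-1 by lra.
  by field; rewrite gt_eqF// addr_gt0.
have q1 : 0 < 1 + q by rewrite addr_gt0.
have den0 : 0 < 1 - expR (- q) by rewrite subr_gt0 expR_lt1 oppr_lt0.
apply: (@le_trans _ _ ((1 + q) * (1 - del + 2 * del ^+ 2))).
  rewrite ler_pdivrMr//; apply: (le_trans num).
  apply: (@le_trans _ _ ((1 + q) * (1 - del + 2 * del ^+ 2) * (q / (1 + q)))).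
    rewrite (_ : _ * (q / _) = (1 - del + 2 * del ^+ 2) * q); last first.
      by field; rewrite gt_eqF.
    rewrite /q mulrA ler_peMl ?(ltW r0)//.
    have : 0 <= del ^+ 2 * (1 + 2 * del) by rewrite mulr_ge0 ?sqr_ge0//; lra.
    by rewrite expr2; nra.
  apply: ler_wpM2l den; rewrite mulr_ge0 ?(ltW q1)//.
  by have := sqr_ge0 del; lra.
rewrite (_ : 2 * r - _ + _ = 2 * r + (- del + 2 * del ^+ 2)); last by ring.
rewrite expRD ler_pM ?(ltW q1)//.
- by have := sqr_ge0 del; lra.
- by apply: le_trans (expR_ge1Dx _); lra.
- by apply: le_trans (expR_ge1Dx _); lra.
Qed.

(** The terms [del * m] cancel, since [m / ro] is the mean. The deviation gains at least
    [4 * dl ^+ 2 * N], while the second-order terms and the lattice cost at most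
    [3 * dl ^+ 2 * N]. *)
Lemma tail_exponent (m N : nat) (ro eps s del dl : R) : (m <= N)%N ->
  0 < ro <= 1 -> 0 < s -> 0 < dl <= 2^-1 -> 4 * dl <= ro * eps ->
  2 <= s * dl ^+ 2 -> `|del| = dl ->
  ((1 - expR (- (ro / s))) / (1 - expR (- ((1 + del) * (ro / s))))) ^+ m *
    expR (ro / s * (s * (del * (m%:R / ro) - dl * (eps * N%:R)))) <=
  expR (- (dl ^+ 2 * N%:R)).
Proof.
move=> mN /andP[ro0 ro1] s0 /andP[dl0 dl2] dle sdl deldl.
have r0 : 0 < ro / s by rewrite divr_gt0.
have del2 : `|del| <= 2^-1 by rewrite deldl.
have delsq : del ^+ 2 = dl ^+ 2 by rewrite -deldl real_normK// num_real.
have rdl : 2 * (ro / s) <= dl ^+ 2.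
  by rewrite mulrA ler_pdivrMr// [leRHS]mulrC; apply: le_trans sdl; lra.
have del12 : -1 < del by move: del2 => /ler_normlP[]; lra.
apply: (@le_trans _ _ (expR (2 * (ro / s) - del + 2 * del ^+ 2) ^+ m *
    expR (ro / s * (s * (del * (m%:R / ro) - dl * (eps * N%:R)))))).
  rewrite ler_wpM2r ?expR_ge0// lerXn2r ?nnegrE ?expR_ge0//; last first.
    exact: geometric_ratio_le.
  rewrite divr_ge0// subr_ge0 expR_le1 oppr_le0 ?(ltW r0)// mulr_ge0 ?(ltW r0)//.
  lra.
rewrite -expRM_natl -expRD ler_expR delsq.
have -> : ro / s * (s * (del * (m%:R / ro) - dl * (eps * N%:R))) =
    del * m%:R - dl * (ro * eps) * N%:R.
  by field; rewrite !gt_eqF.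
have mN' : m%:R <= N%:R :> R by rewrite ler_nat.
have N0 : 0 <= N%:R :> R by [].
have m0 : 0 <= m%:R :> R by [].
have dl20 : 0 <= dl ^+ 2 by exact: sqr_ge0.
have h1 : m%:R * (2 * (ro / s) + 2 * dl ^+ 2) <= N%:R * (3 * dl ^+ 2).
  apply: ler_pM => //; last by lra.
  by rewrite addr_ge0// mulr_ge0// ltW.
have h2 : 4 * dl ^+ 2 * N%:R <= dl * (ro * eps) * N%:R.
  by rewrite ler_wpM2r// (_ : 4 * dl ^+ 2 = dl * (4 * dl)) ?ler_pM2l//; ring.
by move: h1 h2; set A := ro / s; lra.
Qed.

(** [N + 1 <= 8 / c * expR (c * N / 8)], and its fourth power spends half of the decay. The exponent
    4 counts two coordinates of the corner and two of the extent. *)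
Lemma poly_expR_le (c : R) (N : nat) : 0 < c <= 8 ->
  N.+1%:R ^+ 4 * expR (- (c * N%:R)) <=
  (8 / c) ^+ 4 * expR (- (c / 2)) ^+ N.
Proof.
move=> /andP[c0 c8].
have N1 : N.+1%:R <= 8 / c * expR (c * N%:R / 8).
  apply: (@le_trans _ _ (8 / c * (1 + c * N%:R / 8))); last first.
    by rewrite ler_pM2l ?divr_gt0// expR_ge1Dx.
  rewrite (_ : 8 / c * _ = 8 / c + N%:R); last by field; rewrite gt_eqF.
  by rewrite -addn1 natrD addrC lerD2r ler_pdivlMr// mul1r.
apply: (@le_trans _ _ ((8 / c * expR (c * N%:R / 8)) ^+ 4 *
    expR (- (c * N%:R)))).
  by rewrite ler_wpM2r ?expR_ge0// lerXn2r ?nnegrE// (le_trans _ N1).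
rewrite [X in X * _ <= _]exprMn -[leLHS]mulrA.
rewrite ler_wpM2l ?exprn_ge0 ?divr_ge0 ?(ltW c0)//.
by rewrite -!expRM_natl -expRD ler_expR; lra.
Qed.

Lemma geometric_nneseries_lt (K z : R) : 0 <= K -> 0 <= z < 1 ->
  (\sum_(n <oo) (K * z ^+ n)%:E < +oo)%E.
Proof.
move=> K0 /andP[z0 z1]; apply: (@le_lt_trans _ _ (K / (1 - z))%:E); last exact: ltry.
apply: lime_le.
  by apply: is_cvg_nneseries => n _ _; rewrite lee_fin mulr_ge0 ?exprn_ge0.
apply: nearW => n; rewrite sumEFin lee_fin.
have -> : \sum_(0 <= i < n) K * z ^+ i = series (geometric K z) n by [].
rewrite geometric_seriesE ?lt_eqF//= ler_wpM2r ?invr_ge0 ?subr_ge0 ?(ltW z1)//.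
by rewrite ler_piMr// gerBl exprn_ge0.
Qed.

End tails.

Lemma measure_big_setU_le d (T : measurableType d) (R : realType)
    (P : probability T R) (I : eqType) (l : seq I) (A : I -> set T) (c : R) :
  (forall i, i \in l -> measurable (A i) /\ (P (A i) <= c%:E)%E) ->
  measurable (\big[setU/set0]_(i <- l) A i) /\
  (P (\big[setU/set0]_(i <- l) A i) <= ((size l)%:R * c)%:E)%E.
Proof.
elim: l => [_|i l IH h]; first by rewrite big_nil measure0 mul0r.
have [|mU PU] := IH; first by move=> j jl; apply: h; rewrite inE jl orbT.
have [mA PA] := h i (mem_head _ _).
rewrite big_cons; split; first exact: measurableU.
apply: (le_trans (measureU2 _ mA mU)).
by rewrite /= mulrS mulrDl mul1r EFinD; exact: leeD.
Qed.

(** * Concentration of the stationary process *)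

Section stationary.
Context d (Omega : measurableType d) (R : realType) (P : probability Omega R).
Variable X : (int * int)%type -> {RV P >-> R}.
Hypothesis iidX : iid_exponential1 X.

Definition boundary_rate (rho : R) (e : nat * nat) : R :=
  if e.2 == 0%N then 1 - rho else if e.1 == 0%N then rho else 1.

(** The axis weights are rescaled values of [x] itself, which couples all rates to the same field.
    The rate chosen at [(0, 0)] is never seen by [growth]. *)
Definition stationary (rho : R) (x : int * int -> R) u (e : nat * nat) : R :=
  x (site u e) / boundary_rate rho e.

Lemma boundary_rate_gt0 rho e : 0 < rho < 1 -> 0 < boundary_rate rho e.
Proof.
by case/andP=> r0 r1; rewrite /boundary_rate; do 2?case: ifP => _ //; lra.
Qed.

Definition deviation (V : Omega -> nat * nat -> nat) (S : seq (nat * nat))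
    (D : pred (nat * nat)) (ro s eps : R) (N : nat) : set Omega :=
  [set w | eps * N%:R <=
    `|(\sum_(e <- S | D e) (V w e)%:R) / s - (count D S)%:R / ro|].

Lemma not_deviation V S D ro s eps N w : ~ deviation V S D ro s eps N w ->
  `|(\sum_(e <- S | D e) (V w e)%:R) / s - (count D S)%:R / ro| < eps * N%:R.
Proof. by move=> /negP; rewrite -ltNge. Qed.

(** Tilting by [dl] handles the lower tail, by [- dl] the upper one. Only laws are compared, so [V]
    may be a flipped configuration although the reference is read off [X] directly. *)
Lemma deviation_le V (k : nat * nat -> R) (u : int * int) S (D : pred (nat * nat))
    (ro s eps dl : R) (N : nat) :
  uniq S -> (forall e, 0 < k e) -> (forall e, e \in S -> D e -> k e = ro / s) ->
  geometric_law P V k S -> (count D S <= N)%N ->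
  0 < ro <= 1 -> 0 < s -> 0 < dl <= 2^-1 -> 4 * dl <= ro * eps ->
  2 <= s * dl ^+ 2 ->
  measurable (deviation V S D ro s eps N) /\
  (P (deviation V S D ro s eps N) <=
    (2 * expR (- (dl ^+ 2 * N%:R)))%:E)%E.
Proof.
move=> uS k0 kD lawV cN ro01 s0 dl01 dle sdl.
have [ro0 _] := andP ro01; have [dl0 dl2] := andP dl01.
have r0 : 0 < ro / s by rewrite divr_gt0.
pose c : R := (count D S)%:R.
pose A (del : R) := [set w | del * \sum_(e <- S | D e) (V w e)%:R <=
  s * (del * (c / ro) - dl * (eps * N%:R))].
have HA del : `|del| = dl -> measurable (A del) /\
    (P (A del) <= (expR (- (dl ^+ 2 * N%:R)))%:E)%E.
  move=> deldl.
  have del0 : del != 0 by rewrite -normr_gt0 deldl.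
  have del1 : 0 < 1 + del.
    by have : `|del| <= 2^-1 by [rewrite deldl]; move=> /ler_normlP[]; lra.
  pose k' e := if D e then (1 + del) * (ro / s) else k e.
  have k'0 e : 0 < k' e by rewrite /k'; case: ifP => // _; rewrite mulr_gt0.
  have [mA PA] := geometric_law_tail (s * (del * (c / ro) - dl * (eps * N%:R)) / del)
    uS r0 del1 k0 kD lawV (truncn_law iidX u k'0 uS).
  move: mA PA; rewrite [del * (_ / del)]mulrC divfK// => mA PA.
  split => //; apply: (le_trans PA); rewrite lee_fin; exact: tail_exponent.
have -> : deviation V S D ro s eps N = A dl `|` A (- dl).
  apply/seteqP; split => w; rewrite /deviation /A /=; set Z := \sum_(e <- S | D e) _;
    rewrite -/c.
    rewrite ler_normr => /orP[h|h]; [right|left].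
      have : dl * s * (eps * N%:R) <= dl * s * (Z / s - c / ro).
        by rewrite ler_pM2l// mulr_gt0.
      rewrite (_ : dl * s * (Z / s - _) = dl * Z - s * dl * (c / ro)); first lra.
      by field; rewrite !gt_eqF.
    have : dl * s * (eps * N%:R) <= dl * s * - (Z / s - c / ro).
      by rewrite ler_pM2l// mulr_gt0.
    rewrite (_ : dl * s * - (Z / s - _) = - (dl * Z) + s * dl * (c / ro)); first lra.
    by field; rewrite !gt_eqF.
  move=> h; rewrite ler_normr -(ler_pM2l (mulr_gt0 dl0 s0)).
  rewrite -[_ <= - _](ler_pM2l (mulr_gt0 dl0 s0)).
  rewrite (_ : dl * s * (Z / s - _) = dl * Z - s * dl * (c / ro)); last first.
    by field; rewrite !gt_eqF.
  rewrite (_ : dl * s * - (Z / s - _) = - (dl * Z) + s * dl * (c / ro)); last first.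
    by field; rewrite !gt_eqF.
  by case: h => h; apply/orP; [right|left]; lra.
have [m1 P1] := HA dl (gtr0_norm dl0).
have [|m2 P2] := HA (- dl); first by rewrite normrN gtr0_norm.
split; first exact: measurableU.
apply: (le_trans (measureU2 _ m1 m2)).
by rewrite (_ : 2 * _ = expR (- (dl ^+ 2 * N%:R)) + expR (- (dl ^+ 2 * N%:R)));
  [rewrite EFinD leeD|ring].
Qed.

Definition row (e : nat * nat) := (e.2 == 0%N) && (e.1 != 0%N).
Definition column (e : nat * nat) := (e.1 == 0%N) && (e.2 != 0%N).

Lemma perm_row m n :
  perm_eq [seq e <- box m.+1 n.+1 | row e] [seq (i.+1, 0%N) | i <- iota 0 m].
Proof.
apply: uniq_perm; rewrite ?filter_uniq ?uniq_box ?map_inj_uniq ?iota_uniq//.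
  by move=> i j [].
move=> [i j]; rewrite mem_filter mem_box /row /=.
apply/idP/mapP => [h|[a + [-> ->]]]; last by rewrite mem_iota; lia.
exists i.-1; first by rewrite mem_iota; lia.
by congr (_, _); lia.
Qed.

Lemma perm_column m n :
  perm_eq [seq e <- box m.+1 n.+1 | column e] [seq (0%N, j.+1) | j <- iota 0 n].
Proof.
apply: uniq_perm; rewrite ?filter_uniq ?uniq_box ?map_inj_uniq ?iota_uniq//.
  by move=> i j [].
move=> [i j]; rewrite mem_filter mem_box /column /=.
apply/idP/mapP => [h|[a + [-> ->]]]; last by rewrite mem_iota; lia.
exists j.-1; first by rewrite mem_iota; lia.
by congr (_, _); lia.
Qed.

Lemma count_row m n : count row (box m.+1 n.+1) = m.
Proof. by rewrite -size_filter (perm_size (perm_row m n)) size_map size_iota. Qed.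

Lemma count_column m n : count column (box m.+1 n.+1) = n.
Proof.
by rewrite -size_filter (perm_size (perm_column m n)) size_map size_iota.
Qed.

Lemma sum_row m n (f : nat * nat -> R) :
  \sum_(e <- box m.+1 n.+1 | row e) f e = \sum_(i < m) f (i.+1, 0%N).
Proof.
rewrite -big_filter (perm_big _ (perm_row m n)) big_map.
by rewrite -{1}[m]subn0 -/(index_iota 0 m) big_mkord.
Qed.

Lemma sum_column m n (f : nat * nat -> R) :
  \sum_(e <- box m.+1 n.+1 | column e) f e = \sum_(j < n) f (0%N, j.+1).
Proof.
rewrite -big_filter (perm_big _ (perm_column m n)) big_map.
by rewrite -{1}[n]subn0 -/(index_iota 0 n) big_mkord.
Qed.

(** Dividing by [boundary_rate rho e / s] puts all rescaled weights on the common lattice of mesh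
    [1 / s]. The parameters become [boundary_rate rho e / s], and [(1 - rho) + rho = 1] is the
    balance that [flip_law] asks for. *)
Definition discretized (rho s : R) u (w : Omega) (e : nat * nat) : nat :=
  Num.truncn (X (site u e) w / (boundary_rate rho e / s)).

Definition increment_deviation (rho s eps : R) (N : nat) u m n : set Omega :=
  deviation (discretized rho s u) (box m.+1 n.+1) column rho s eps N `|`
  deviation (fun w => flip_rows (discretized rho s u w) m n) (box m.+1 n.+1)
    row (1 - rho) s eps N.

Lemma increment_deviation_le rho s eps dl N u m n :
  0 < rho < 1 -> 0 < s -> 0 < dl <= 2^-1 -> 4 * dl <= rho * eps ->
  4 * dl <= (1 - rho) * eps -> 2 <= s * dl ^+ 2 -> (m <= N)%N -> (n <= N)%N ->
  measurable (increment_deviation rho s eps N u m n) /\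
  (P (increment_deviation rho s eps N u m n) <=
    (4 * expR (- (dl ^+ 2 * N%:R)))%:E)%E.
Proof.
move=> rho01 s0 dl01 dl1 dl2 sdl mN nN; have [rho0 rho1] := andP rho01.
pose k e := boundary_rate rho e / s.
have k0 e : 0 < k e by rewrite divr_gt0// boundary_rate_gt0.
have law0 : geometric_law P (discretized rho s u) k (box m.+1 n.+1).
  exact: truncn_law (uniq_box _ _).
have law1 : geometric_law P (fun w => flip_rows (discretized rho s u w) m n) k
    (box m.+1 n.+1).
  apply: flip_rows_law law0 => i j.
  by rewrite /k /boundary_rate /=; ring.
have kc e : e \in box m.+1 n.+1 -> column e -> k e = rho / s.
  by rewrite /k /boundary_rate => _ /andP[/eqP -> /negPf ->].
have kr e : e \in box m.+1 n.+1 -> row e -> k e = (1 - rho) / s.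
  by rewrite /k /boundary_rate => _ /andP[/eqP -> _].
have cc : (count column (box m.+1 n.+1) <= N)%N by rewrite count_column.
have cr : (count row (box m.+1 n.+1) <= N)%N by rewrite count_row.
have rho01' : 0 < rho <= 1 by lra.
have rho01'' : 0 < 1 - rho <= 1 by lra.
have [m1 P1] := deviation_le u (uniq_box _ _) k0 kc law0 cc rho01' s0 dl01 dl1 sdl.
have [m2 P2] := deviation_le u (uniq_box _ _) k0 kr law1 cr rho01'' s0 dl01 dl2 sdl.
split; first exact: measurableU.
apply: (le_trans (measureU2 _ m1 m2)).
apply: (le_trans (leeD P1 P2)).
by rewrite -EFinD lee_fin; lra.
Qed.

(** Three errors of size [eps * N] add up: the left column, the top row, and the rounding of at most
    [2 * N] weights by [1 / s] each. *)
Lemma stationary_near rho s eps N u m n w : 0 < rho < 1 -> 0 < s -> 2 <= eps * s ->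
  (m <= N)%N -> (n <= N)%N ->
  (forall z, 0 <= X z w) -> ~ increment_deviation rho s eps N u m n w ->
  `|growth (stationary rho (fun z => X z w) u) m n -
     (m%:R / (1 - rho) + n%:R / rho)| <= 3 * eps * N%:R.
Proof.
move=> rho01 s0 epss mN nN X0 /not_orP[/not_deviation + /not_deviation].
rewrite count_row count_column.
have := growth_flip_rows R (discretized rho s u w) m n.
rewrite -(sum_row m n (fun e => (flip_rows (discretized rho s u w) m n e)%:R)).
rewrite -(sum_column m n (fun e => (discretized rho s u w e)%:R)).
set g := growth _ m n; set A := \sum_(e <- _ | column e) _.
set B := \sum_(e <- _ | row e) _ => gE.
move=> /ltr_normlP[A1 A2] /ltr_normlP[B1 B2].
pose v e : R := (discretized rho s u w e)%:R / s.
have gv : growth v m n = g / s.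
  rewrite /g /v; elim/growth_ind: m / n {mN nN A B g gE A1 A2 B1 B2} => [|j|i|i j].
  - by rewrite !growth00 mul0r.
  - by rewrite !growth0S mulrDl => ->.
  - by rewrite !growthS0 mulrDl => ->.
  - by rewrite !growthSS mulrDl => -> ->; rewrite maxr_pMl// invr_ge0 ltW.
have vs e : v e <= stationary rho (fun z => X z w) u e <= v e + s^-1.
  rewrite /v /stationary /discretized; set x := X _ w; set b := boundary_rate _ _.
  have b0 : 0 < b by exact: boundary_rate_gt0.
  have y0 : 0 <= x / (b / s) by rewrite divr_ge0 ?X0// divr_ge0// ltW.
  have -> : x / b = x / (b / s) / s by field; rewrite !gt_eqF.
  have := truncn_itv y0; set t := Num.truncn _ => /andP[t1 /ltW t2].
  rewrite -[X in _ + X]mul1r -mulrDl -mulrSr !ler_pM2r ?invr_gt0//.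
  by rewrite t1 t2.
have le1 : growth v m n <= growth (stationary rho (fun z => X z w) u) m n.
  have := @le_growth _ v (stationary rho (fun z => X z w) u) 0 m n.
  by rewrite mul0rn addr0; apply => e; rewrite addr0; case/andP: (vs e).
have le2 : growth (stationary rho (fun z => X z w) u) m n <=
    growth v m n + s^-1 *+ (m + n).
  by apply: le_growth => e; case/andP: (vs e).
have s2 : s^-1 *+ (m + n) <= eps * N%:R.
  rewrite -[s^-1 *+ _]mulr_natr; apply: (@le_trans _ _ (s^-1 * (2 * N%:R))).
    by rewrite ler_pM2l ?invr_gt0// -natrM ler_nat mul2n -addnn leq_add.
  by rewrite mulrA ler_wpM2r// mulrC ler_pdivrMr.
rewrite ler_norml; move: le1 le2; rewrite gv gE mulrDl => le1 le2.
by apply/andP; split; lra.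
Qed.

Definition int_box (N : nat) : seq (int * int) :=
  [seq (i%:Z - N%:Z, j%:Z - N%:Z) | i <- iota 0 (N + N).+1, j <- iota 0 (N + N).+1].

Lemma mem_int_box N u : `|u.1| <= N%:Z -> `|u.2| <= N%:Z -> u \in int_box N.
Proof.
move=> u1 u2; apply/allpairsP.
exists (absz (u.1 + N%:Z), absz (u.2 + N%:Z)); rewrite !mem_iota /=.
case: u u1 u2 => a b /= u1 u2; split; try lia.
by congr (_, _); lia.
Qed.

(** A union bound over the corners in [int_box N] and the extents up to [N] at each scale, followed
    by Borel-Cantelli. *)
Lemma stationary_ae (rho eps : R) : 0 < rho < 1 -> 0 < eps <= 1 ->
  {ae P, forall w, exists N0 : nat, forall N, (N0 <= N)%N ->
    forall u, `|u.1| <= N%:Z -> `|u.2| <= N%:Z ->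
    forall m n, (m <= N)%N -> (n <= N)%N ->
    `|growth (stationary rho (fun z => X z w) u) m n -
       (m%:R / (1 - rho) + n%:R / rho)| <= 3 * eps * N%:R}.
Proof.
move=> rho01 /andP[eps0 eps1]; have [rho0 rho1] := andP rho01.
(* Chosen so that [4 * dl] is below both [rho * eps] and [(1 - rho) * eps]; [s] is then the smallest
   value with [2 <= s * dl ^+ 2]. *)
pose dl : R := rho * (1 - rho) * eps / 4.
have rr : 0 < rho * (1 - rho) by rewrite mulr_gt0// subr_gt0.
have rr1 : rho * (1 - rho) <= rho by rewrite ler_piMr//; lra.
have rr2 : rho * (1 - rho) <= 1 - rho by rewrite ler_piMl//; lra.
have dl0 : 0 < dl by rewrite divr_gt0// mulr_gt0.
have dl4 : 4 * dl = rho * (1 - rho) * eps by rewrite /dl; field.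
have dl_eps : 4 * dl <= eps by rewrite dl4 ler_piMl//; lra.
pose s : R := 2 / dl ^+ 2.
have s0 : 0 < s by rewrite divr_gt0// exprn_gt0.
have sdl : s * dl ^+ 2 = 2 by rewrite /s divfK// expf_neq0// gt_eqF.
have epss : 2 <= eps * s.
  rewrite -sdl mulrC ler_pM2r//; apply: (le_trans _ dl_eps).
  by rewrite expr2 ler_wpM2r// ?ltW//; lra.
pose l N := [seq (u, e) | u <- int_box N, e <- box N.+1 N.+1].
pose F N := \big[setU/set0]_(i <- l N)
  increment_deviation rho s eps N i.1 i.2.1 i.2.2.
have HF N : measurable (F N) /\
    (P (F N) <= ((size (l N))%:R * (4 * expR (- (dl ^+ 2 * N%:R))))%:E)%E.
  apply: measure_big_setU_le => -[u [m n]] /allpairsP[[u' e] /= [_ + [_ mn]]].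
  rewrite -mn mem_box /= !ltnS => /andP[mN nN].
  apply: increment_deviation_le => //; rewrite ?sdl//.
  - by rewrite dl0; lra.
  - by rewrite dl4 ler_wpM2r// ltW.
  - by rewrite dl4 ler_wpM2r// ltW.
have c0 : 0 < dl ^+ 2 by rewrite exprn_gt0.
have c8 : dl ^+ 2 <= 8 by rewrite expr2; nra.
have sl N : (size (l N))%:R <= 4 * N.+1%:R ^+ 4 :> R.
  rewrite -natrX -natrM ler_nat /l !size_allpairs !size_iota.
  have h : ((N + N).+1 <= 2 * N.+1)%N by clear; lia.
  have -> : (4 * N.+1 ^ 4 = 2 * N.+1 * (2 * N.+1) * (N.+1 * N.+1))%N by ring.
  exact: leq_mul (leq_mul h h) (leqnn _).
have sumF : (\sum_(N <oo) P (F N) < +oo)%E.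
  apply: (@le_lt_trans _ _
    (\sum_(N <oo) (16 * (8 / dl ^+ 2) ^+ 4 * expR (- (dl ^+ 2 / 2)) ^+ N)%:E)%E).
    apply: lee_nneseries => // N _; apply: (le_trans (HF N).2); rewrite lee_fin.
    apply: (@le_trans _ _ (16 * (N.+1%:R ^+ 4 * expR (- (dl ^+ 2 * N%:R))))).
      rewrite (_ : 16 * _ = 4 * N.+1%:R ^+ 4 * (4 * expR (- (dl ^+ 2 * N%:R))));
        last by ring.
      by rewrite ler_wpM2r// mulr_ge0// expR_ge0.
    by rewrite -[leRHS]mulrA ler_pM2l//; apply: poly_expR_le; rewrite c0.
  apply: geometric_nneseries_lt.
    by rewrite mulr_ge0// exprn_ge0// divr_ge0// ltW.
  by rewrite expR_ge0 expR_lt1 oppr_lt0 divr_gt0.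
have mF N : measurable (F N) by case: (HF N).
have F0 := lim_sup_set_cvg0 mF sumF.
have aeF : {ae P, forall w, ~ lim_sup_set F w}.
  exists (lim_sup_set F); split => //.
    by apply: bigcapT_measurable => n; exact: bigcup_measurable.
  by move=> w /=; exact: contrapT.
apply: filterS2 (ae_exponential_ge0 iidX) aeF => w X0.
move=> /existsNP[N0 nF]; exists N0 => N N0N u u1 u2 m n mN nN.
apply: (@stationary_near rho s eps N u m n w) => // wdev.
apply: nF => _; exists N => //=.
rewrite /F -bigcup_seq; exists (u, (m, n)) => //=.
apply/allpairsP; exists (u, (m, n)); split => //=; first exact: mem_int_box.
by rewrite mem_box /= !ltnS mN.
Qed.

End stationary.

(** * The shape function *)

Section lpp_shape.
Variable R : realType.
Implicit Types (a b m n r rho t N : R).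

Definition lpp_shape a b : R := (Num.sqrt a + Num.sqrt b) ^+ 2.

(** Completing the square. Read forwards, it bounds the loss from a rate that is not optimal; read
    backwards, a small gap forces the direction to be nearly characteristic. *)
Lemma lpp_shape_gap a b r : 0 <= a -> 0 <= b -> 0 < r < 1 ->
  a / (1 - r) + b / r - lpp_shape a b =
  (Num.sqrt a * r - Num.sqrt b * (1 - r)) ^+ 2 / (r * (1 - r)).
Proof.
move=> a0 b0 /andP[r0 r1]; rewrite -{1}(sqr_sqrtr a0) -{1}(sqr_sqrtr b0) /lpp_shape.
have r1' : 1 - r != 0 by rewrite gt_eqF// subr_gt0.
by field; rewrite r1' gt_eqF.
Qed.

Lemma lpp_shape_le_linear a b r : 0 <= a -> 0 <= b -> 0 < r < 1 ->
  lpp_shape a b <= a / (1 - r) + b / r.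
Proof.
move=> a0 b0 r01; rewrite -subr_ge0 lpp_shape_gap// divr_ge0 ?sqr_ge0//.
by case/andP: r01 => r0 r1; rewrite ltW// mulr_gt0// subr_gt0.
Qed.

Lemma lpp_shapeC a b : lpp_shape a b = lpp_shape b a.
Proof. by rewrite /lpp_shape addrC. Qed.

Lemma lpp_shapeE a b : 0 <= a -> 0 <= b ->
  lpp_shape a b = a + b + 2 * (Num.sqrt a * Num.sqrt b).
Proof. by move=> a0 b0; rewrite /lpp_shape sqrrD !sqr_sqrtr//; ring. Qed.

Lemma le_lpp_shape a b a' b' : 0 <= a -> 0 <= b -> a <= a' -> b <= b' ->
  lpp_shape a b <= lpp_shape a' b'.
Proof.
move=> a0 b0 aa bb; rewrite /lpp_shape lerXn2r ?nnegrE ?addr_ge0 ?sqrtr_ge0//.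
by rewrite lerD// ler_wsqrtr.
Qed.

(* The rho for which (a, b) is the characteristic direction. *)
Definition best_rate a b : R := Num.sqrt b / (Num.sqrt a + Num.sqrt b).

Lemma best_rateE a b r : 0 < a -> 0 <= b ->
  Num.sqrt a * r - Num.sqrt b * (1 - r) =
  (Num.sqrt a + Num.sqrt b) * (r - best_rate a b).
Proof.
move=> a0 b0; rewrite /best_rate; field.
by rewrite gt_eqF// ltr_pwDl ?sqrtr_gt0// sqrtr_ge0.
Qed.

Lemma best_rate01 a b : 0 < a -> 0 < b -> 0 < best_rate a b < 1.
Proof.
rewrite -sqrtr_gt0 => a0; rewrite -sqrtr_gt0 => b0.
by rewrite /best_rate divr_gt0 ?addr_gt0//= ltr_pdivrMr ?addr_gt0// mul1r ltrDr.
Qed.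

(** Replaces the optimal rate by one of the rates controlled almost surely. The endpoints, where the
    stationary process degenerates, are excluded. *)
Lemma grid_near M t : (1 < M)%N -> 0 <= t <= 1 ->
  exists2 i : nat, (0 < i < M)%N & `|i%:R / M%:R - t| <= M%:R^-1.
Proof.
move=> M1 /andP[t0 t1]; have M0 : 0 < M%:R :> R by rewrite ltr0n; lia.
have tM0 : 0 <= t * M%:R by rewrite mulr_ge0// ltW.
suff [i iM /ler_normlP[i1 i2]] : exists2 i : nat, (0 < i < M)%N &
    `|i%:R - t * M%:R| <= 1.
  exists i => //; rewrite -(ler_pM2r M0) mulVf ?gt_eqF//.
  rewrite -[X in _ * X <= _](gtr0_norm M0) -normrM mulrBl divfK ?gt_eqF//.
  by rewrite ler_norml; apply/andP; split; lra.
have /andP[k1 k2] := truncn_itv tM0; set k := Num.truncn _ in k1 k2.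
have tM1 : t * M%:R <= M%:R by rewrite ler_piMl// ltW.
move: k2; rewrite -natr1 => k2.
have kM : (k <= M)%N by rewrite -(ler_nat R); exact: le_trans tM1.
case: (posnP k) => [k0|k0].
  exists 1%N; first lia.
  by move: k2; rewrite k0 ler_norml => k2; apply/andP; split; lra.
case: (ltnP k M) => [kM'|Mk].
  by exists k; [lia|rewrite ler_norml; apply/andP; split; lra].
exists k.-1; first lia.
have -> : k.-1%:R = k%:R - 1 :> R by rewrite -[in RHS](prednK k0) -natr1 addrK.
have kME : k%:R = M%:R :> R by congr _%:R; lia.
by rewrite ler_norml; apply/andP; split; lra.
Qed.

Lemma rate_defect a b N r iM : 0 < a <= N -> 0 <= b <= N -> 0 <= iM ->
  `|r - best_rate a b| <= iM ->
  `|Num.sqrt a * r - Num.sqrt b * (1 - r)| <= 2 * Num.sqrt N * iM.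
Proof.
move=> /andP[a0 aN] /andP[b0 bN] iM0 riM; rewrite best_rateE// normrM.
rewrite ger0_norm ?addr_ge0 ?sqrtr_ge0//.
apply: ler_pM => //; rewrite ?addr_ge0 ?sqrtr_ge0//.
by rewrite mulrDl mul1r lerD// ler_wsqrtr.
Qed.

(** Here [k] is the exit point and [T] the passage time. By the last hypothesis the gap at
    [(m - k, n)] has order [tau ^+ 2 * N]; being a square, it forces [sqrt (m - k) * rho] close to
    [sqrt n * (1 - rho)], and so is [sqrt m * rho]. Hence [k] is small, and the hypothesis before it
    bounds [T] from below. *)
Lemma exit_bound m n k N rho tau iM T :
  0 <= k <= m -> 0 <= m <= N -> 0 <= n <= N -> 0 < rho < 1 -> 0 <= tau ->
  0 <= iM ->
  `|Num.sqrt m * rho - Num.sqrt n * (1 - rho)| <= 2 * Num.sqrt N * iM ->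
  m / (1 - rho) + n / rho <= k / (1 - rho) + T + 3 * tau ^+ 2 * N ->
  m / (1 - rho) + n / rho <=
    k / (1 - rho) + lpp_shape (m - k) n + 4 * tau ^+ 2 * N ->
  lpp_shape m n <= T +
    N * (3 * tau ^+ 2 + (4 * iM + 4 * tau) / (rho * (1 - rho))).
Proof.
move=> /andP[k0 km] /andP[m0 mN] /andP[n0 nN] rho01 tau0 iM0 near1 H1 H2.
have [rho0 rho1] := andP rho01; have rho1' : 0 < 1 - rho by rewrite subr_gt0.
have mk0 : 0 <= m - k by rewrite subr_ge0.
have N0 : 0 <= N by exact: le_trans mN.
have := lpp_shape_gap mk0 n0 rho01; have := lpp_shape_le_linear m0 n0 rho01.
move: near1 H2; set p := Num.sqrt m; set q := Num.sqrt n; set s := Num.sqrt (m - k).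
set w := Num.sqrt N => near1 H2 le_lin gap.
have w0 : 0 <= w by exact: sqrtr_ge0.
have wE : w ^+ 2 = N by exact: sqr_sqrtr.
have pE : p ^+ 2 = m by exact: sqr_sqrtr.
have sE : s ^+ 2 = m - k by exact: sqr_sqrtr.
have sp : s <= p by rewrite ler_wsqrtr// gerBl.
have pw : p <= w by exact: ler_wsqrtr.
have s0 : 0 <= s by exact: sqrtr_ge0.
have rr : 0 < rho * (1 - rho) by rewrite mulr_gt0.
have rr1 : rho * (1 - rho) <= 1 by rewrite mulr_ile1 ?(ltW rho0) ?(ltW rho1)//; lra.
have near2 : `|s * rho - q * (1 - rho)| <= 2 * tau * w.
  have W : 0 <= 2 * tau * w by rewrite !mulr_ge0.
  rewrite -(ger0_norm W) -ler_sqr ?nnegrE// !real_normK ?num_real//.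
  apply: (@le_trans _ _ ((4 * tau ^+ 2 * N) * (rho * (1 - rho)))).
    rewrite -ler_pdivrMr// -gap; move: H2.
    by rewrite (_ : m / (1 - rho) = (m - k) / (1 - rho) + k / (1 - rho)); [lra|
      rewrite -mulrDl subrK].
  rewrite -wE (_ : (2 * tau * w) ^+ 2 = 4 * tau ^+ 2 * w ^+ 2); last by ring.
  by rewrite ler_piMr// mulr_ge0 ?mulr_ge0 ?sqr_ge0.
have h : rho * (p - s) <= 2 * w * (iM + tau).
  by move: near1 near2 => /ler_normlP[_ ?] /ler_normlP[? _]; lra.
have kE : rho * k <= N * (4 * iM + 4 * tau).
  have -> : rho * k = rho * (p - s) * (p + s).
    by rewrite (_ : k = p ^+ 2 - s ^+ 2); [ring|rewrite pE sE; ring].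
  apply: (@le_trans _ _ (2 * w * (iM + tau) * (w + w))).
    apply: ler_pM => //; last by apply: lerD => //; exact: le_trans pw.
      by rewrite mulr_ge0 ?(ltW rho0)// subr_ge0.
    by rewrite addr_ge0// (le_trans s0).
  by rewrite -wE; lra.
have kE' : k / (1 - rho) <= N * ((4 * iM + 4 * tau) / (rho * (1 - rho))).
  rewrite mulrA ler_pdivlMr// (_ : k / _ * _ = rho * k)//.
  by field; rewrite gt_eqF.
by rewrite mulrDr; lra.
Qed.

(** A small [best_rate] means that [sqrt n] is at most [2 * del * sqrt N], so everything in the
    shape except [m] is of order [del * N]. *)
Lemma lpp_shape_axis m n N del : 0 < m <= N -> 0 <= n <= N -> 0 <= del <= 1 ->
  best_rate m n <= del -> lpp_shape m n <= m + 8 * del * N.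
Proof.
move=> /andP[m0 mN] /andP[n0 nN] /andP[d0 d1].
rewrite /best_rate ler_pdivrMr ?ltr_pwDl ?sqrtr_gt0 ?sqrtr_ge0// => h.
rewrite lpp_shapeE ?(ltW m0)//.
have N0 : 0 <= N by apply: le_trans mN; exact: ltW.
have pw := ler_wsqrtr mN; have qw := ler_wsqrtr nN.
have nE := sqr_sqrtr n0; have NE := sqr_sqrtr N0.
move: h pw qw nE NE; set p := Num.sqrt m; set q := Num.sqrt n; set w := Num.sqrt N.
move=> h pw qw nE NE.
have p0 : 0 <= p by exact: sqrtr_ge0.
have q0 : 0 <= q by exact: sqrtr_ge0.
have w0 : 0 <= w by exact: sqrtr_ge0.
have h' : q <= 2 * del * w.
  by have := ler_wpM2l d0 (lerD pw qw); lra.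
have pq : p * q <= w * (2 * del * w) by exact: ler_pM.
have qq : q * q <= w * (2 * del * w) by exact: ler_pM.
by rewrite -NE -nE; move: pq qq; rewrite !expr2; lra.
Qed.

End lpp_shape.

(** * Point-to-point passage times *)

Lemma natr_ratio_itv (R : realType) M i : (0 < i < M)%N ->
  0 < (i%:R / M%:R : R) < 1.
Proof.
move=> /andP[i0 iM]; have M0 : (0 < M)%N by exact: leq_trans iM.
by rewrite divr_gt0 ?ltr0n//= ltr_pdivrMr ?ltr0n// mul1r ltr_nat.
Qed.

Section shape_theorem.
Variable R : realType.
Implicit Types (x : int * int -> R) (u z : int * int).

Definition passage x z i j : R := x z + growth (fun e => x (site z e)) i j.

Lemma eventually_bounded (Q : nat -> nat -> Prop) M :
  (forall i, (i < M)%N -> exists N0, forall N, (N0 <= N)%N -> Q i N) ->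
  exists N0, forall N, (N0 <= N)%N -> forall i, (i < M)%N -> Q i N.
Proof.
elim: M => [|M IH] h; first by exists 0%N.
have [i iM|N1 h1] := IH; first by apply: h; exact: ltnW.
have [N2 h2] := h M (ltnSn M).
exists (maxn N1 N2) => N; rewrite geq_max => /andP[N1N N2N] i.
by rewrite ltnS leq_eqVlt => /orP[/eqP ->|]; [exact: h2|exact: h1].
Qed.

(** Together with nonnegativity, this is all that the deterministic part uses about the random
    field. Uniformity in the corner [u] is what allows moving starting points. *)
Definition stationary_limit x (rho : R) : Prop := forall eps : R, 0 < eps ->
  exists N0 : nat, forall N, (N0 <= N)%N ->
  forall u, `|u.1| <= N%:Z -> `|u.2| <= N%:Z ->
  forall m n, (m <= N)%N -> (n <= N)%N ->
  `|growth (stationary rho x u) m n - (m%:R / (1 - rho) + n%:R / rho)| <=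
    eps * N%:R.

Variable x : int * int -> R.
Hypothesis x_ge0 : forall z, 0 <= x z.
Hypothesis x_limit : forall M i, (0 < i < M)%N ->
  stationary_limit x (i%:R / M%:R).

(** One threshold for all rates of a grid. The box is enlarged by one because the corner of the
    stationary process sits one step before the start of the path. *)
Lemma grid_limit M (eps : R) : 0 < eps -> exists N0 : nat, forall N,
  (N0 <= N)%N -> forall i, (0 < i < M)%N ->
  forall u, `|u.1| <= N%:Z + 1 -> `|u.2| <= N%:Z + 1 ->
  forall m n, (m <= N)%N -> (n <= N)%N ->
  `|growth (stationary (i%:R / M%:R) x u) m n -
    (m%:R / (1 - i%:R / M%:R) + n%:R / (i%:R / M%:R))| <= eps * N%:R.
Proof.
move=> eps0.
have [|N0 h] := @eventually_bounded (fun i N => (0 < i < M)%N ->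
  forall u, `|u.1| <= N%:Z + 1 -> `|u.2| <= N%:Z + 1 ->
  forall m n, (m <= N)%N -> (n <= N)%N ->
  `|growth (stationary (i%:R / M%:R) x u) m n -
    (m%:R / (1 - i%:R / M%:R) + n%:R / (i%:R / M%:R))| <= eps * N%:R) M.
  move=> i _; case: (boolP (0 < i < M)%N) => iM; last by exists 0%N.
  have [|N0 h] := x_limit iM (eps := eps / 2); first by rewrite divr_gt0.
  exists N0.+1 => N N0N _ u u1 u2 m n mN nN.
  apply: (le_trans (h N.+1 _ u _ _ m n _ _)); [lia|lia|lia|lia|lia|].
  have N1 : 1 <= N%:R :> R by rewrite (ler_nat R 1); lia.
  by rewrite -[N.+1%:R]natr1; have := ler_wpM2l (ltW eps0) N1; lra.
by exists N0 => N N0N i iM; apply: h => //; lia.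
Qed.

Lemma site_le_passage z i j : x (site z (i, j)) <= passage x z i j.
Proof.
have g0 a b : 0 <= growth (fun e => x (site z e)) a b by exact: growth_ge0.
rewrite /passage; case: i => [|i].
  case: j => [|j]; first by rewrite site0 addr0.
  have := growth_stepr (fun e => x (site z e)) 0 j.
  by have := g0 0%N j; have := x_ge0 z; lra.
have := growth_stepl (fun e => x (site z e)) i j.
by have := g0 i j; have := x_ge0 z; lra.
Qed.

Lemma passage_super z k l i j : (k <= i)%N -> (l <= j)%N ->
  passage x (site z (k, l)) (i - k) (j - l) <= passage x z i j.
Proof.
move=> ki lj; have := growth_super (fun e => x (site z e)) k l (i - k) (j - l).
rewrite !subnKC//.
under [X in _ + X <= _]eq_growth do rewrite -(siteD z (k, l)).
by have := site_le_passage z k l; rewrite /passage; lra.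
Qed.

Lemma le_passage z i j k l : (k <= i)%N -> (l <= j)%N ->
  passage x z k l <= passage x z i j.
Proof.
move=> ki lj; have := growth_super (fun e => x (site z e)) k l (i - k) (j - l).
rewrite !subnKC// /passage.
set g := growth (fun e => x (site z (_, _))) _ _.
have : 0 <= g by exact: growth_ge0.
lra.
Qed.

Lemma stationary_bulk rho u i j :
  stationary rho x u (1 + i, 1 + j)%N = x (site (site u (1, 1)%N) (i, j)).
Proof. by rewrite /stationary /boundary_rate /= divr1 siteD. Qed.

Lemma stationary_ge0 rho u e : 0 < rho < 1 -> 0 <= stationary rho x u e.
Proof. by move=> rho01; rewrite divr_ge0// ltW// boundary_rate_gt0. Qed.

Lemma passage_le_stationary rho u i j : 0 < rho < 1 ->
  passage x (site u (1, 1)%N) i j <= growth (stationary rho x u) i.+1 j.+1.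
Proof.
move=> rho01; have := growth_super (stationary rho x u) 1 1 i j.
under [X in _ + X <= _]eq_growth do rewrite stationary_bulk -surjective_pairing.
apply: le_trans; rewrite lerD2r.
have := growth_stepl (stationary rho x u) 0 1.
rewrite (stationary_bulk rho u 0 0) site0; apply: le_trans.
by rewrite lerDr growth_ge0// => e; exact: stationary_ge0.
Qed.

Lemma stationary_exit rho u i j :
  (exists2 k, (k <= i)%N & growth (stationary rho x u) i.+1 j.+1 <=
    growth (stationary rho x u) k.+1 0 +
    passage x (site (site u (1, 1)%N) (k, 0)%N) (i - k) j) \/
  (exists2 l, (l <= j)%N & growth (stationary rho x u) i.+1 j.+1 <=
    growth (stationary rho x u) 0 l.+1 +
    passage x (site (site u (1, 1)%N) (0, l)%N) i (j - l)).
Proof.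
have [[k ki h]|[l lj h]] := growth_exit (stationary rho x u) i j.
  left; exists k => //; apply: (le_trans h); rewrite -addrA lerD2l /passage.
  rewrite -(stationary_bulk rho u k 0) lerD2l le_eqVlt; apply/orP; left; apply/eqP.
  apply: eq_growth => -[a b] /=.
  by rewrite -add1n -addnA stationary_bulk; congr (x _); rewrite [RHS]siteD.
right; exists l => //; apply: (le_trans h); rewrite -addrA lerD2l /passage.
rewrite -(stationary_bulk rho u 0 l) lerD2l le_eqVlt; apply/orP; left; apply/eqP.
apply: eq_growth => -[a b] /=.
by rewrite -(add1n l) -addnA stationary_bulk; congr (x _); rewrite [RHS]siteD.
Qed.

(** Since axis weights are [x] over a constant, laws of large numbers along lines can be read off
    the stationary process. *)
Lemma stationary_row rho u i :
  growth (stationary rho x u) i.+1 0 = passage x (site u (1, 0)%N) i 0 / (1 - rho).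
Proof.
elim: i => [|i IH].
  by rewrite /passage growthS0 !growth00 add0r addr0 /stationary /boundary_rate.
rewrite growthS0 IH /passage growthS0 /stationary /boundary_rate /= siteD.
by rewrite -mulrDl addrA.
Qed.

Lemma stationary_column rho u j :
  growth (stationary rho x u) 0 j.+1 = passage x (site u (0, 1)%N) 0 j / rho.
Proof.
elim: j => [|j IH].
  by rewrite /passage growth0S !growth00 add0r addr0 /stationary /boundary_rate.
rewrite growth0S IH /passage growth0S /stationary /boundary_rate /= siteD.
by rewrite -mulrDl addrA.
Qed.

Lemma rate_ge M i : (0 < i < M)%N ->
  M%:R^-1 <= i%:R / M%:R :> R /\ M%:R^-1 <= 1 - i%:R / M%:R :> R.
Proof.
move=> /andP[i0 iM]; have M0 : 0 < M%:R :> R by rewrite ltr0n; lia.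
split; first by rewrite ler_peMl ?invr_ge0 ?(ltW M0)// (ler_nat R 1).
rewrite -{2}(divff (lt0r_neq0 M0)) -mulrBl ler_peMl ?invr_ge0 ?(ltW M0)//.
by rewrite -natrB 1?ltnW// (ler_nat R 1) subn_gt0.
Qed.

Lemma passage_upper (eps : R) : 0 < eps -> exists N0 : nat, forall N,
  (N0 <= N)%N -> forall z, `|z.1| <= N%:Z -> `|z.2| <= N%:Z ->
  forall i j, (i < N)%N -> (j < N)%N ->
  passage x z i j <= lpp_shape i.+1%:R j.+1%:R + eps * N%:R.
Proof.
move=> eps0; have e20 : 0 < eps / 2 by rewrite divr_gt0.
(* The gap at a grid rate is at most [4 * N / M ^+ 2] over [r * (1 - r)], and the latter is at least
   [1 / (2 * M)]: in all [8 * N / M], that is, at most [eps / 2 * N]. *)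
pose M := (Num.truncn (16 / eps)).+2.
have M1 : (1 < M)%N by [].
have M0 : 0 < M%:R :> R by rewrite ltr0n.
have eM : 8 / M%:R <= eps / 2.
  rewrite ler_pdivrMr// -ler_pdivrMl// invf_div ltW//.
  rewrite (_ : 2 / eps * 8 = 16 / eps); last by field; rewrite gt_eqF.
  by apply: (lt_trans (truncnS_gt _)); rewrite ltr_nat.
have [N0 h] := grid_limit M e20.
exists N0 => N N0N z z1 z2 i j iN jN.
pose u : int * int := (z.1 - 1, z.2 - 1).
have zE : z = site u (1, 1)%N by rewrite /site /= !subrK -surjective_pairing.
have u1 : `|u.1| <= N%:Z + 1 by clear -z1; rewrite /u /=; lia.
have u2 : `|u.2| <= N%:Z + 1 by clear -z2; rewrite /u /=; lia.
have m0 : 0 < i.+1%:R :> R by rewrite ltr0n.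
have n0 : 0 < j.+1%:R :> R by rewrite ltr0n.
have mN : i.+1%:R <= N%:R :> R by rewrite ler_nat.
have nN : j.+1%:R <= N%:R :> R by rewrite ler_nat.
have NR0 : 0 <= N%:R :> R by [].
have /andP[b0 b1] := best_rate01 m0 n0.
have [|k kM kr] := @grid_near R M (best_rate i.+1%:R j.+1%:R) M1.
  by rewrite !ltW.
have k01 := natr_ratio_itv R kM; have [k0 k1] := rate_ge kM.
have /ler_normlP[_ hk] := h N N0N k kM u u1 u2 i.+1 j.+1 iN jN.
rewrite zE; apply: (le_trans (passage_le_stationary _ _ _ k01)).
have gap := lpp_shape_gap (ltW m0) (ltW n0) k01.
have iM0 : 0 <= M%:R^-1 :> R by rewrite invr_ge0 ltW.
have mN' : 0 < (i.+1%:R : R) <= N%:R by rewrite m0.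
have nN' : 0 <= (j.+1%:R : R) <= N%:R by rewrite (ltW n0).
have defect := rate_defect mN' nN' iM0 kr.
move: gap hk k0 k1 defect; set r := k%:R / M%:R; set A := _ - _ * (1 - r).
move=> gap hk k0 k1 defect.
suff : A ^+ 2 / (r * (1 - r)) <= 8 / M%:R * N%:R.
  by have := ler_wpM2r NR0 eM; clear -gap hk; lra.
have /andP[r0 r1] := k01; rewrite -/r in r0 r1.
have rr0 : 0 < r * (1 - r) by rewrite mulr_gt0// subr_gt0.
have rr : M%:R^-1 / 2 <= r * (1 - r).
  case: (lerP r 2^-1) => r2.
    by clear -r0 r2 k0; have := ler_wpM2l (ltW r0) (_ : 2^-1 <= 1 - r); lra.
  by clear -r1 r2 k1; have := ler_wpM2r (_ : 0 <= 1 - r) (ltW r2); lra.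
rewrite ler_pdivrMr//.
have A2 : A ^+ 2 <= (2 * Num.sqrt N%:R * M%:R^-1) ^+ 2.
  by rewrite -[A ^+ 2]real_normK ?num_real// lerXn2r ?nnegrE// !mulr_ge0.
apply: (le_trans A2); rewrite !exprMn sqr_sqrtr//.
apply: (@le_trans _ _ (8 / M%:R * N%:R * (M%:R^-1 / 2))).
  by clear; rewrite !expr2; lra.
by rewrite ler_wpM2l// mulr_ge0// divr_ge0// ltW.
Qed.

End shape_theorem.

(** * Lower bound on passage times through exit points *)

Lemma normr_int_pred (a : int) (N : nat) :
  `|a| <= N%:Z -> `|a - 1| <= N%:Z + 1 /\ `|a| <= N%:Z + 1.
Proof. by lia. Qed.

Lemma site_in_box z e N : `|z.1| <= N%:Z -> `|z.2| <= N%:Z ->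
  (e.1 <= N)%N -> (e.2 <= N)%N ->
  `|(site z e).1| <= (N + N)%:Z /\ `|(site z e).2| <= (N + N)%:Z.
Proof. by case: z => a b; case: e => c d; rewrite /site /=; lia. Qed.

Section shape_lower.
Variables (R : realType) (x : int * int -> R).
Hypothesis x_ge0 : forall z, 0 <= x z.
Hypothesis x_limit : forall M i, (0 < i < M)%N ->
  stationary_limit x (i%:R / M%:R).

(** At rate 1/2 an axis sum is twice the passage time along a line, so the stationary limit contains
    the law of large numbers for straight paths. *)
Lemma passage_lower_axis (eps : R) : 0 < eps -> exists N0 : nat, forall N,
  (N0 <= N)%N -> forall z, `|z.1| <= N%:Z -> `|z.2| <= N%:Z ->
  forall i j, (i < N)%N -> (j < N)%N ->
  i.+1%:R <= passage x z i j + eps * N%:R /\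
  j.+1%:R <= passage x z i j + eps * N%:R.
Proof.
move=> eps0; have [N0 h] := grid_limit x_limit 2 eps0.
exists N0 => N N0N z z1 z2 i j iN jN.
pose u1 : int * int := (z.1 - 1, z.2); pose u2 : int * int := (z.1, z.2 - 1).
have [a1 b1] := normr_int_pred z1; have [b2 a2] := normr_int_pred z2.
have E1 : site u1 (1, 0)%N = z.
  by rewrite /site /= subrK addr0 -surjective_pairing.
have E2 : site u2 (0, 1)%N = z.
  by rewrite /site /= subrK addr0 -surjective_pairing.
have /ler_normlP[+ _] := h N N0N 1%N isT u1 a1 a2 i.+1 0%N iN (leq0n _).
have /ler_normlP[+ _] := h N N0N 1%N isT u2 b1 b2 0%N j.+1 (leq0n _) jN.
rewrite stationary_row stationary_column E1 E2.
have := le_passage x_ge0 z (leq0n i) (leqnn j).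
have := le_passage x_ge0 z (leqnn i) (leq0n j).
set p := passage x z i j; set q := passage x z i 0; set r := passage x z 0 j.
have -> : 1%:R / 2%:R = 2^-1 :> R by rewrite div1r.
have -> : 1 - 2^-1 = 2^-1 :> R by field.
rewrite !invrK !mul0r !addr0 !add0r => qp rp hr hq.
have : 0 <= eps * N%:R by rewrite mulr_ge0 ?(ltW eps0).
by split; lra.
Qed.

Lemma passage_lower (eps : R) : 0 < eps <= 1 -> exists N0 : nat, forall N,
  (N0 <= N)%N -> forall z, `|z.1| <= N%:Z -> `|z.2| <= N%:Z ->
  forall i j, (i < N)%N -> (j < N)%N ->
  lpp_shape i.+1%:R j.+1%:R <= passage x z i j + eps * N%:R.
Proof.
move=> /andP[eps0 eps1].
(* [del] separates directions near an axis. [tau] makes [8 * tau / (del / 4)] equal to [eps / 4];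
   errors are controlled at [tau ^+ 2] because the gap is quadratic. *)
pose del : R := eps / 32; pose tau : R := del * eps / 128.
have del0 : 0 < del by rewrite divr_gt0.
have del1 : del <= 32^-1 by rewrite /del; lra.
have tau0 : 0 < tau by rewrite divr_gt0// mulr_gt0.
have tau_del : tau <= del / 128.
  by rewrite /tau ler_wpM2r// ler_piMr// ltW.
have tau_eps : tau <= eps / 128.
  by rewrite /tau ler_wpM2r// ler_piMl// ?ltW//; lra.
pose e1 := tau ^+ 2.
have e10 : 0 < e1 by rewrite exprn_gt0.
have e1_eps : e1 <= eps / 128.
  by apply: le_trans tau_eps; rewrite /e1 expr2 ler_piMl ?ltW//; lra.
pose M := (Num.truncn tau^-1).+2.
have M1 : (1 < M)%N by [].
have M0 : 0 < M%:R :> R by rewrite ltr0n.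
have iM0 : 0 <= M%:R^-1 :> R by rewrite invr_ge0 ltW.
have iMtau : M%:R^-1 <= tau.
  rewrite -[tau]invrK lef_pV2 ?posrE ?invr_gt0// ltW//.
  by apply: (lt_trans (truncnS_gt _)); rewrite ltr_nat.
(* Halved because [passage_upper] is applied at scale [N + N]: an exit site may leave the box of
   radius [N]. *)
have e120 : 0 < e1 / 2 by rewrite divr_gt0.
have [Na ha] := passage_lower_axis e120.
have [Nu hu] := passage_upper x_ge0 x_limit e120.
have [Ng hg] := grid_limit x_limit M e10.
(* Makes [M], hence the inverse rates, at most [e1 * N]: an axis sum up to the exit has [k + 1]
   terms where [exit_bound] counts [k]. *)
pose Nm := (Num.truncn (M%:R / e1)).+1.
exists (maxn (maxn Na Nu) (maxn Ng Nm)) => N.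
rewrite !geq_max => /andP[/andP[NaN NuN] /andP[NgN NmN]] z z1 z2 i j iN jN.
have MN : M%:R <= e1 * N%:R.
  rewrite -ler_pdivrMl// mulrC ltW//; apply: (lt_le_trans (truncnS_gt _)).
  by rewrite ler_nat.
have [Hm Hn] := ha N NaN z z1 z2 i j iN jN.
pose u : int * int := (z.1 - 1, z.2 - 1).
have zE : site u (1, 1)%N = z by rewrite /site /= !subrK -surjective_pairing.
have [u1 _] := normr_int_pred z1; have [u2 _] := normr_int_pred z2.
set m : R := i.+1%:R; set n : R := j.+1%:R.
have m0 : 0 < m by rewrite ltr0n.
have n0 : 0 < n by rewrite ltr0n.
have mN : m <= N%:R by rewrite ler_nat.
have nN : n <= N%:R by rewrite ler_nat.
have NR0 : 0 <= N%:R :> R by [].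
have mN' : 0 < m <= N%:R by rewrite m0.
have nN' : 0 < n <= N%:R by rewrite n0.
have mN'' : 0 <= m <= N%:R by rewrite ltW.
have nN'' : 0 <= n <= N%:R by rewrite ltW.
have del01 : 0 <= del <= 1 by clear -del0 del1; lra.
set T := passage x z i j in Hm Hn *.
have epsN : 0 <= eps * N%:R by rewrite mulr_ge0// ltW.
have e1N : e1 * N%:R <= eps / 128 * N%:R by rewrite ler_wpM2r.
(* Near an axis [rho * (1 - rho)] is too small for [exit_bound], but there a straight path already
   comes within [eps * N] of the shape. *)
case: (lerP (best_rate m n) del) => [rd|rd].
  have := lpp_shape_axis mN' nN'' del01 rd.
  by clear -Hm e1N epsN; rewrite /del; lra.
case: (lerP (best_rate n m) del) => [rd'|rd'].
  have := lpp_shape_axis nN' mN'' del01 rd'.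
  by clear -Hn e1N epsN; rewrite lpp_shapeC /del; lra.
have rateC : best_rate n m = 1 - best_rate m n.
  rewrite /best_rate addrC; field.
  by rewrite gt_eqF// addr_gt0// sqrtr_gt0.
have /andP[b0 b1] := best_rate01 m0 n0.
have [|k0 kM kr] := @grid_near R M (best_rate m n) M1; first by rewrite !ltW.
set rho : R := k0%:R / M%:R in kr.
have rho01 : 0 < rho < 1.
  exact: natr_ratio_itv.
have [rho0 rho1] := andP rho01.
have [rho_d rho_d'] : del / 2 <= rho /\ del / 2 <= 1 - rho.
  move: kr => /ler_normlP[k1 k2].
  by clear -k1 k2 rd rd' rateC iMtau tau_del; split; lra.
have rr : del / 4 <= rho * (1 - rho).
  clear -rho_d rho_d' rho0 rho1; case: (lerP rho 2^-1) => r2.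
    by have := ler_wpM2l (ltW rho0) (_ : 2^-1 <= 1 - rho); lra.
  by have := ler_wpM2r (_ : 0 <= 1 - rho) (ltW r2); lra.
have rr0 : 0 < rho * (1 - rho) by apply: lt_le_trans rr; rewrite divr_gt0.
have defect := rate_defect mN' nN'' iM0 kr.
have err : N%:R * (3 * tau ^+ 2 + (4 * M%:R^-1 + 4 * tau) / (rho * (1 - rho))) <=
    eps * N%:R.
  rewrite [leRHS]mulrC ler_wpM2l//.
  have : (4 * M%:R^-1 + 4 * tau) / (rho * (1 - rho)) <= eps / 4.
    rewrite ler_pdivrMr//; apply: (@le_trans _ _ (eps / 4 * (del / 4))).
      by clear -iMtau; move: iMtau; rewrite /tau; lra.
    by rewrite ler_wpM2l// divr_ge0// ltW.
  by clear -e1_eps eps0; move: e1_eps; rewrite /e1; lra.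
have rate_inv : 1 / (1 - rho) <= M%:R /\ 1 / rho <= M%:R.
  have [r0 r1] := rate_ge R kM; rewrite -/rho in r0 r1.
  by rewrite !div1r -[M%:R]invrK !lef_pV2 ?posrE ?invr_gt0// subr_gt0.
have /ler_normlP[L1 _] := hg N NgN k0 kM u u1 u2 i.+1 j.+1 iN jN.
rewrite -/rho -/m -/n in L1.
have NuNN : (Nu <= N + N)%N by exact: leq_trans NuN (leq_addr _ _).
have ltNN a : (a < N)%N -> (a < N + N)%N.
  by move=> aN; apply: leq_trans aN (leq_addr _ _).
have [[k ki ex]|[l lj ex]] := stationary_exit x rho u i j; rewrite zE in ex.
  have kN : (k < N)%N by exact: leq_ltn_trans iN.
  have /ler_normlP[_ B1] := hg N NgN k0 kM u u1 u2 k.+1 0%N kN (leq0n _).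
  rewrite -/rho mul0r addr0 -natr1 mulrDl in B1.
  have [w1 w2] := site_in_box (e := (k, 0)%N) z1 z2 (ltnW kN) (leq0n N).
  have U := hu (N + N)%N NuNN _ w1 w2 _ _
    (ltNN _ (leq_ltn_trans (leq_subr k i) iN)) (ltNN _ jN).
  have T1 := passage_super x_ge0 z ki (leq0n j).
  rewrite subn0 -/T in T1.
  have mk : (i - k).+1%:R = m - k%:R :> R by rewrite -subSn// natrB// leqW.
  rewrite mk -/n natrD in U.
  have k_m : 0 <= (k%:R : R) <= m by rewrite ler0n ler_nat leqW.
  apply: le_trans (exit_bound (T := T) k_m mN'' nN'' rho01 (ltW tau0) iM0 defect _ _) _.
  - by move: rate_inv.1; rewrite -/e1; clear -L1 ex B1 U T1 MN; lra.
  - by move: rate_inv.1; rewrite -/e1; clear -L1 ex B1 U T1 MN; lra.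
  - by rewrite lerD2l.
have lN : (l < N)%N by exact: leq_ltn_trans jN.
have /ler_normlP[_ B1] := hg N NgN k0 kM u u1 u2 0%N l.+1 (leq0n _) lN.
rewrite -/rho mul0r add0r -natr1 mulrDl in B1.
have [w1 w2] := site_in_box (e := (0, l)%N) z1 z2 (leq0n N) (ltnW lN).
have U := hu (N + N)%N NuNN _ w1 w2 _ _ (ltNN _ iN)
  (ltNN _ (leq_ltn_trans (leq_subr l j) jN)).
have T1 := passage_super x_ge0 z (leq0n i) lj.
rewrite subn0 -/T in T1.
have nl : (j - l).+1%:R = n - l%:R :> R by rewrite -subSn// natrB// leqW.
rewrite nl -/m natrD lpp_shapeC in U.
have l_n : 0 <= (l%:R : R) <= n by rewrite ler0n ler_nat leqW.
(* An exit along the vertical axis is the previous case reflected in the diagonal, which exchanges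
   [m] with [n] and [rho] with [1 - rho]. *)
have rhoC : 1 - (1 - rho) = rho by rewrite subKr.
have rho01C : 0 < 1 - rho < 1 by rewrite subr_gt0 rho1 gtrBl.
have defectC : `|Num.sqrt n * (1 - rho) - Num.sqrt m * (1 - (1 - rho))| <=
    2 * Num.sqrt N%:R * M%:R^-1.
  by rewrite rhoC distrC.
rewrite lpp_shapeC.
have := exit_bound (T := T) l_n nN'' mN'' rho01C (ltW tau0) iM0 defectC.
rewrite rhoC [(1 - rho) * rho]mulrC => bound.
apply: le_trans (bound _ _) _.
- by move: rate_inv.2; rewrite -/e1; clear -L1 ex B1 U T1 MN; lra.
- by move: rate_inv.2; rewrite -/e1; clear -L1 ex B1 U T1 MN; lra.
- by rewrite lerD2l.
Qed.

End shape_lower.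

(** * Maximization along the boundary *)

Section boundary.
Variable R : realType.
Implicit Types (a b k m n p q lam sig N W : R).

(* The limit shape when only the boundary points A_k are kept; for the points
   B_m exchange the coordinates and replace lam by 1 - rho. *)
Definition half_shape lam a b : R :=
  if b * (1 - lam) ^+ 2 <= a * lam ^+ 2 then lpp_shape a b
  else a / (1 - lam) + b / lam.

(** The square root is not Lipschitz at 0; [sqrt (y + sig ^+ 2 * N) <= sqrt y + sig * sqrt N] gives
    a modulus valid up to the axes. *)
Lemma lpp_shape_perturb p q sig D N : 0 <= sig -> 0 <= D -> 0 <= N ->
  0 <= p <= D ^+ 2 * N -> 0 <= q <= D ^+ 2 * N ->
  lpp_shape (p + sig ^+ 2 * N) (q + sig ^+ 2 * N) <=
  lpp_shape p q + (8 * sig * D + 4 * sig ^+ 2) * N.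
Proof.
move=> s0 D0 N0 /andP[p0 pW] /andP[q0 qW].
have NE := sqr_sqrtr N0.
have bound y : 0 <= y -> y <= D ^+ 2 * N ->
    Num.sqrt y <= D * Num.sqrt N /\
    Num.sqrt (y + sig ^+ 2 * N) <= Num.sqrt y + sig * Num.sqrt N.
  move=> y0 yW; have w0 : 0 <= Num.sqrt N by exact: sqrtr_ge0.
  have dE c : 0 <= c -> Num.sqrt (c ^+ 2 * N) = c * Num.sqrt N.
    by move=> c0; rewrite sqrtrM ?sqr_ge0// sqrtr_sqr ger0_norm.
  split; first by rewrite -dE//; exact: ler_wsqrtr.
  have v0 : 0 <= Num.sqrt y + sig * Num.sqrt N.
    by rewrite addr_ge0 ?sqrtr_ge0// mulr_ge0.
  rewrite -ler_sqr ?nnegrE ?sqrtr_ge0// sqr_sqrtr ?addr_ge0 ?mulr_ge0 ?sqr_ge0//.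
  rewrite sqrrD exprMn NE sqr_sqrtr// addrAC lerDl.
  by rewrite mulrn_wge0// mulr_ge0 ?sqrtr_ge0// mulr_ge0.
have [bp1 bp2] := bound p p0 pW; have [bq1 bq2] := bound q q0 qW.
rewrite /lpp_shape; move: NE bp1 bp2 bq1 bq2.
set P := Num.sqrt p; set Q := Num.sqrt q; set w := Num.sqrt N.
set P' := Num.sqrt (p + _); set Q' := Num.sqrt (q + _).
move=> NE bp1 bp2 bq1 bq2.
have w0 : 0 <= w by exact: sqrtr_ge0.
have P0 : 0 <= P by exact: sqrtr_ge0.
have Q0 : 0 <= Q by exact: sqrtr_ge0.
apply: (@le_trans _ _ ((P + Q + 2 * (sig * w)) ^+ 2)).
  rewrite lerXn2r ?nnegrE ?addr_ge0 ?sqrtr_ge0 ?mulr_ge0//.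
  lra.
have sw : 0 <= sig * w by exact: mulr_ge0.
have := ler_wpM2l sw (lerD bp1 bq1).
by rewrite -NE !expr2; lra.
Qed.

(** Bound the shape by the linear form of a fixed rate [r]. Along the boundary this form is constant
    for [r = lam] and decreases in [k] for [r <= lam]; in the first case [r] is the best rate of
    [(a, b)], which is then at most [lam]. *)
Lemma shape_along_boundary lam a b k : 0 < lam <= 1 -> 0 < a -> 0 < b ->
  0 <= k <= b ->
  lpp_shape (a + (1 - lam) / lam * k) (b - k) <= half_shape lam a b.
Proof.
move=> /andP[l0 l1] a0 b0 /andP[k0 kb].
have c0 : 0 <= (1 - lam) / lam by rewrite divr_ge0 ?subr_ge0// ltW.
have p0 : 0 <= a + (1 - lam) / lam * k by rewrite addr_ge0 ?(ltW a0)// mulr_ge0.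
have q0 : 0 <= b - k by rewrite subr_ge0.
rewrite /half_shape; case: ifP => [cond|/negbT].
  have /andP[r0 r1] := best_rate01 a0 b0; set r := best_rate a b in r0 r1.
  have r01 : 0 < r < 1 by rewrite r0.
  have r1' : 0 < 1 - r by rewrite subr_gt0.
  have rE : Num.sqrt a * r = Num.sqrt b * (1 - r).
    by apply/eqP; rewrite -subr_eq0 best_rateE ?(ltW b0)// subrr mulr0.
  have sa : 0 < Num.sqrt a by rewrite sqrtr_gt0.
  have sb : 0 < Num.sqrt b by rewrite sqrtr_gt0.
  have rlam : r <= lam.
    have le1 : Num.sqrt b * (1 - lam) <= Num.sqrt a * lam.
      rewrite -ler_sqr ?nnegrE ?mulr_ge0 ?(ltW sa) ?(ltW sb) ?(ltW l0) ?subr_ge0//.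
      by rewrite !exprMn !sqr_sqrtr// ltW.
    have : (Num.sqrt a + Num.sqrt b) * r <= (Num.sqrt a + Num.sqrt b) * lam by lra.
    by rewrite ler_pM2l// addr_gt0.
  have gap := lpp_shape_gap (ltW a0) (ltW b0) r01.
  move: gap; rewrite rE subrr expr0n mul0r => /eqP; rewrite subr_eq0 => /eqP gap.
  apply: (le_trans (lpp_shape_le_linear p0 q0 r01)); rewrite -gap.
  rewrite -subr_ge0.
  have -> : a / (1 - r) + b / r - ((a + (1 - lam) / lam * k) / (1 - r) + (b - k) / r)
    = k * (lam - r) / (lam * r * (1 - r)).
    by field; rewrite !gt_eqF.
  by rewrite divr_ge0 ?mulr_ge0 ?subr_ge0 ?(ltW l0) ?(ltW r0) ?(ltW r1).
rewrite -ltNge => cond.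
have l1' : lam < 1.
  rewrite lt_neqAle l1 andbT; apply/eqP => lE; move: cond.
  by rewrite lE subrr expr0n mulr0 expr1n mulr1 ltNge ltW.
have l01 : 0 < lam < 1 by rewrite l0.
apply: (le_trans (lpp_shape_le_linear p0 q0 l01)).
rewrite le_eqVlt; apply/orP; left; apply/eqP; field.
by rewrite !gt_eqF// subr_gt0.
Qed.

(* k is chosen so that (a + c k, b - k) is the characteristic direction. *)
Lemma shape_boundary_attained lam a b : 0 < lam < 1 -> 0 < a -> 0 < b ->
  a * lam ^+ 2 < b * (1 - lam) ^+ 2 ->
  exists2 k, 0 <= k < b &
    lpp_shape (a + (1 - lam) / lam * k) (b - k) = a / (1 - lam) + b / lam.
Proof.
move=> l01 a0 b0 cond; have [l0 l1] := andP l01.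
have l1' : 0 < 1 - lam by rewrite subr_gt0.
exists ((b * (1 - lam) ^+ 2 - a * lam ^+ 2) / (1 - lam)).
  rewrite divr_ge0 ?subr_ge0 ?(ltW cond) ?(ltW l1)//= ltr_pdivrMr//.
  have : 0 < b * (1 - lam) * lam by rewrite !mulr_gt0.
  have : 0 < a * lam ^+ 2 by rewrite mulr_gt0// exprn_gt0.
  by rewrite !expr2; lra.
set p := a + _; set q := b - _.
have pE : p = (1 - lam) * (a + (1 - lam) * b / lam).
  by rewrite /p; field; rewrite !gt_eqF.
have qE : q = (lam / (1 - lam)) ^+ 2 * p.
  by rewrite pE /q; field; rewrite !gt_eqF.
have p0 : 0 < p.
  by rewrite pE mulr_gt0// addr_gt0// divr_gt0// mulr_gt0.
have t0 : 0 <= lam / (1 - lam) by rewrite divr_ge0 ?(ltW l0) ?(ltW l1').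
have q0 : 0 <= q by rewrite qE mulr_ge0 ?sqr_ge0// ltW.
have gap := lpp_shape_gap (ltW p0) q0 l01; move: gap.
have -> : Num.sqrt q = lam / (1 - lam) * Num.sqrt p.
  by rewrite qE sqrtrM ?sqr_ge0// sqrtr_sqr ger0_norm.
rewrite (_ : _ - _ * (1 - lam) = 0); last by field; rewrite gt_eqF.
rewrite expr0n mul0r => /eqP; rewrite subr_eq0 => /eqP <-.
by rewrite pE qE pE; field; rewrite !gt_eqF.
Qed.

End boundary.

Lemma normr_neg_succ (c : int) (n : nat) :
  c < 0 -> (absz c <= n)%N -> `|c + 1| <= n%:Z.
Proof. by lia. Qed.

Section boundary_limit.
Variable R : realType.
Implicit Types (T : int * int -> nat -> nat -> R) (alpha : nat -> int).

(** Abstract in [T] so that it also applies to passage times with the coordinates exchanged. The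
    successors count sites instead of steps. *)
Definition shape_limit T : Prop := forall eps : R, 0 < eps ->
  exists N0 : nat, forall N, (N0 <= N)%N ->
  forall z, `|z.1| <= N%:Z -> `|z.2| <= N%:Z ->
  forall i j, (i < N)%N -> (j < N)%N ->
  `|T z i j - lpp_shape i.+1%:R j.+1%:R| <= eps * N%:R.

(** The finitely many indices before convergence sets in contribute a constant, absorbed by
    [eta * N] for large [N]. *)
Lemma slope_bound alpha (c : R) :
  (fun k : nat => (alpha k)%:~R / k%:R : R) @ \oo --> - c ->
  forall eta : R, 0 < eta -> exists N0 : nat, forall N, (N0 <= N)%N ->
  forall k, (0 < k)%N -> (k <= N)%N ->
  `|(alpha k)%:~R + c * k%:R| <= eta * N%:R.
Proof.
move=> /cvgrPdist_le cvg eta eta0; have [K _ hK] := cvg _ eta0.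
pose C : R := \sum_(k < K) `|(alpha k)%:~R + c * k%:R|.
exists (Num.truncn (C / eta)).+1 => N CN k k0 kN.
have NC : C <= eta * N%:R.
  rewrite -ler_pdivrMl// mulrC ltW//; apply: (lt_le_trans (truncnS_gt _)).
  by rewrite ler_nat.
have [kK|Kk] := ltnP k K.
  apply: le_trans NC; rewrite /C (bigD1 (Ordinal kK))//= lerDl.
  by apply: sumr_ge0.
have k0' : 0 < k%:R :> R by rewrite ltr0n.
have := hK k Kk; rewrite -normrN opprB opprK /= => h.
apply: (@le_trans _ _ (eta * k%:R)); last by rewrite ler_pM2l// ler_nat.
rewrite -ler_pdivrMr// -[X in _ / X](gtr0_norm k0') -normf_div mulrDl.
by rewrite mulfK ?gt_eqF.
Qed.

(** The start has abscissa [alpha k + 1], hence the predecessor in the number of steps to the right.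
    The upper bound holds at every [k] by [shape_along_boundary]; the lower bound needs a single
    good [k]. *)
Lemma boundary_limit T alpha (lam : R) : shape_limit T -> 0 < lam <= 1 ->
  (forall k, (0 < k)%N -> alpha k < 0) ->
  (fun k : nat => (alpha k)%:~R / k%:R : R) @ \oo --> - ((1 - lam) / lam) ->
  forall eps : R, 0 < eps <= 1 -> exists N0 : nat, forall a b : nat,
  (0 < a)%N -> (0 < b)%N -> (N0 <= a + b)%N ->
  let t k := T (ptA alpha k) (a + absz (alpha k)).-1 (b - k)%N in
  (forall k, (0 < k <= b)%N ->
    t k <= half_shape lam a%:R b%:R + eps * (a + b)%:R) /\
  (exists2 k, (0 < k <= b)%N &
    half_shape lam a%:R b%:R - eps * (a + b)%:R <= t k).
Proof.
move=> shapeT /andP[l0 l1] alpha0 slope eps /andP[eps0 eps1].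
have l01 : 0 < lam <= 1 by rewrite l0.
set c := (1 - lam) / lam in slope.
have c0 : 0 <= c by rewrite divr_ge0 ?subr_ge0// ltW.
(* In units of [N], [D] bounds all coordinates and displacements, as the boundary reaches out to
   about [c * N]. [sig] then keeps the error of [lpp_shape_perturb] below [eps / 2 * N]. *)
pose D := (Num.truncn (c + 2)).+1.
have Dc : c + 2 <= D%:R by rewrite ltW// truncnS_gt.
have D0 : 0 < D%:R :> R by rewrite ltr0n.
have D1 : 1 <= D%:R :> R by lra.
pose sig : R := eps / (32 * D%:R).
have sig0 : 0 < sig by rewrite divr_gt0// mulr_gt0.
have sigD : 8 * sig * D%:R = eps / 4 by rewrite /sig; field; rewrite gt_eqF.
have sig_eps : sig <= eps / 32.
  by rewrite /sig invfM mulrA ler_piMr ?invf_le1// ltW// divr_gt0.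
have sig2 : sig ^+ 2 <= eps / 32.
  have sig1 : sig <= 1 by lra.
  by apply: le_trans sig_eps; rewrite expr2 ler_piMl// ltW.
(* Half of [sig ^+ 2 * N] pays for the fluctuation of the slope, the other half, through [Nc], for
   shifts of [k] by at most one. *)
pose eta := sig ^+ 2 / 2.
have eta0 : 0 < eta by rewrite divr_gt0// exprn_gt0.
have [Na ha] := slope_bound slope eta0.
have e20 : 0 < eps / (2 * D%:R) by rewrite divr_gt0// mulr_gt0.
have [Ns hs] := shapeT _ e20.
pose Nc := (Num.truncn ((c + 1) / eta)).+1.
exists (maxn (maxn Na Ns) Nc) => a b a0 b0.
rewrite !geq_max => /andP[/andP[NaN NsN] NcN].
set N := (a + b)%N in NaN NsN NcN *.
have cN : c + 1 <= eta * N%:R.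
  rewrite -ler_pdivrMl// mulrC ltW//; apply: (lt_le_trans (truncnS_gt _)).
  by rewrite ler_nat.
have NR : N%:R = a%:R + b%:R :> R by rewrite natrD.
have a0' : 0 < a%:R :> R by rewrite ltr0n.
have b0' : 0 < b%:R :> R by rewrite ltr0n.
have N0 : 0 <= N%:R :> R by exact: ler0n.
have NsDN : (Ns <= D * N)%N by apply: leq_trans NsN _; rewrite leq_pmull.
have D2N : D%:R * N%:R <= D%:R ^+ 2 * N%:R :> R.
  by rewrite expr2 -mulrA ler_peMl// mulr_ge0// ltW.
have ND : (c + 2) * N%:R <= D%:R * N%:R by rewrite ler_wpM2r.
have etaN : eta * N%:R <= N%:R by rewrite ler_piMl// /eta; lra.
pose err := (8 * sig * D%:R + 4 * sig ^+ 2) * N%:R.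
have errE : err <= eps / 2 * N%:R by rewrite /err ler_wpM2r// sigD; lra.
have sigN : sig ^+ 2 * N%:R = 2 * (eta * N%:R) by rewrite /eta; field.
have local k : (0 < k <= b)%N ->
  [/\ `|T (ptA alpha k) (a + absz (alpha k)).-1 (b - k)%N -
       lpp_shape (a + absz (alpha k))%:R (b - k).+1%:R| <= eps / 2 * N%:R,
    `|(absz (alpha k))%:R - c * k%:R| <= eta * N%:R &
    (a + absz (alpha k))%:R <= D%:R * N%:R :> R].
  move=> /andP[k0 kb].
  have kN : (k <= N)%N by apply: leq_trans kb (leq_addl _ _).
  have ak := alpha0 k k0.
  have hk := ha N NaN k k0 kN.
  have alE : (absz (alpha k))%:R = - (alpha k)%:~R :> R.
    by rewrite natr_absz ltr0_norm// mulrNz.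
  have hk' : `|(absz (alpha k))%:R - c * k%:R| <= eta * N%:R.
    by rewrite alE -normrN opprB opprK addrC.
  have kNR : k%:R <= b%:R :> R by rewrite ler_nat.
  have mD : (a + absz (alpha k))%:R <= D%:R * N%:R :> R.
    rewrite natrD; move: hk' => /ler_normlP[_ hk'].
    have ck : c * k%:R <= c * b%:R by rewrite ler_wpM2l.
    have : 0 <= c * a%:R by rewrite mulr_ge0.
    by move: ND etaN hk'; rewrite NR; lra.
  split => //.
  have mD' : (a + absz (alpha k) <= D * N)%N by rewrite -(ler_nat R) natrM.
  have NDN : (N <= D * N)%N by rewrite leq_pmull.
  have p1 : `|(ptA alpha k).1| <= (D * N)%:Z.
    exact: normr_neg_succ ak (leq_trans (leq_addl _ _) mD').
  have p2 : `|(ptA alpha k).2| <= (D * N)%:Z.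
    by rewrite /ptA /= lez_nat (leq_trans kN).
  have i1 : ((a + absz (alpha k)).-1 < D * N)%N.
    by rewrite prednK// addn_gt0 a0.
  have j1 : (b - k < D * N)%N.
    apply: leq_trans NDN; apply: leq_ltn_trans (leq_subr k b) _.
    by rewrite /N -add1n leq_add2r.
  have := hs _ NsDN _ p1 p2 _ _ i1 j1.
  rewrite prednK ?addn_gt0 ?a0// natrM (_ : eps / _ * _ = eps / 2 * N%:R)//.
  by field; rewrite gt_eqF.
have bk_bound k : (0 < k <= b)%N ->
    [/\ (b - k).+1%:R = b%:R - k%:R + 1 :> R, 0 <= b%:R - k%:R :> R,
      b%:R - k%:R + 1 <= D%:R * N%:R :> R & 1 <= k%:R :> R].
  move=> /andP[k0 kb]; rewrite -natr1 natrB// subr_ge0 ler_nat (ler_nat R 1).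
  split => //.
  have : 1 <= k%:R :> R by rewrite (ler_nat R 1).
  have : 0 <= c * N%:R by rewrite mulr_ge0.
  by move: ND; rewrite NR; lra.
split=> [k kb|].
  have [/ler_normlP[_ t1] /ler_normlP[_ t2] mD] := local k kb.
  have [nE bk0 nD k1] := bk_bound k kb; rewrite nE natrD in t1.
  have k01 : 0 <= (k%:R : R) <= b%:R by rewrite ler0n ler_nat; case/andP: kb.
  have pert := @lpp_shape_perturb R (a%:R + c * k%:R) (b%:R - k%:R) sig D%:R N%:R
    (ltW sig0) (ltW D0) N0.
  have along := shape_along_boundary l01 a0' b0' k01; rewrite -/c in along.
  have ck0 : 0 <= c * k%:R by rewrite mulr_ge0.
  have ckN : c * k%:R <= c * N%:R.
    by rewrite ler_wpM2l// ler_nat (leq_trans _ (leq_addl _ _))//; case/andP: kb.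
  have P1 : 0 <= a%:R + c * k%:R <= D%:R ^+ 2 * N%:R.
    by rewrite addr_ge0 ?(ltW a0')//=; clear -D2N ND NR ckN b0' N0; lra.
  have P2 : 0 <= (b%:R - k%:R : R) <= D%:R ^+ 2 * N%:R.
    by rewrite bk0 /=; clear -D2N nD; lra.
  move: (pert P1 P2); rewrite -/err => pert'.
  have le1 : lpp_shape (a%:R + (absz (alpha k))%:R) (b%:R - k%:R + 1) <=
      lpp_shape (a%:R + c * k%:R + sig ^+ 2 * N%:R) (b%:R - k%:R + sig ^+ 2 * N%:R).
    by apply: le_lpp_shape; [exact: addr_ge0 (ltW a0') _|clear -bk0; lra|
      clear -t2 sigN c0 cN; lra|clear -sigN c0 cN; lra].
  by clear -t1 le1 pert' along errE; lra.
rewrite /half_shape; case: ifP => [_|/negbT].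
  (* The first boundary point suffices: its path has [b] levels and at least [a] columns, and the
     shape is monotone. *)
  exists 1%N => //; have [/ler_normlP[t1 _] _ _] := local 1%N b0.
  have le1 : lpp_shape a%:R b%:R <=
      lpp_shape (a + absz (alpha 1%N))%:R (b - 1).+1%:R :> R.
    by apply: le_lpp_shape; rewrite ?ler_nat//; [exact: leq_addr|rewrite subn1 prednK].
  have : 0 <= eps * N%:R by rewrite mulr_ge0// ltW.
  by clear -t1 le1; lra.
rewrite -ltNge => cond.
have l1' : lam < 1.
  rewrite lt_neqAle l1 andbT; apply/eqP => lE; move: cond.
  by rewrite lE subrr expr0n mulr0 expr1n mulr1 ltNge ltW.
have l01' : 0 < lam < 1 by rewrite l0.
have [ks /andP[ks0 ksb] <-] := shape_boundary_attained l01' a0' b0' cond.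
rewrite -/c.
have /andP[tr1 tr2] := truncn_itv ks0; rewrite -natr1 in tr2.
(* An integer within one of the optimal [ks], raised to 1 because indices start there. *)
pose k := maxn 1 (Num.truncn ks).
have kb : (0 < k <= b)%N.
  rewrite /k leq_max /= geq_max b0 /= -(ler_nat R).
  by apply: le_trans tr1 (ltW ksb).
have k1 : ks - 1 <= k%:R.
  rewrite lerBlDr; apply: (le_trans (ltW tr2)).
  by rewrite lerD2r ler_nat leq_maxr.
have k2 : k%:R <= ks + 1.
  by rewrite /k natr_max ge_max; apply/andP; split; [clear -ks0|clear -tr1]; lra.
exists k => //.
have [/ler_normlP[t1 _] /ler_normlP[t2 _] mD] := local k kb.
have [nE bk0 nD _] := bk_bound k kb; rewrite nE natrD in t1.
rewrite natrD in mD.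
set al : R := (absz (alpha k))%:R in t1 t2 mD.
have al0 : 0 <= al by [].
have P1 : 0 <= a%:R + al <= D%:R ^+ 2 * N%:R.
  by rewrite addr_ge0//=; clear -D2N mD; lra.
have P2 : 0 <= (b%:R - k%:R + 1 : R) <= D%:R ^+ 2 * N%:R.
  by rewrite addr_ge0//=; clear -D2N nD; lra.
have := lpp_shape_perturb (ltW sig0) (ltW D0) N0 P1 P2; rewrite -/err => pert.
have ck := ler_wpM2l c0 k1.
have cks : 0 <= c * ks by rewrite mulr_ge0.
have le1 : lpp_shape (a%:R + c * ks) (b%:R - ks) <=
    lpp_shape (a%:R + al + sig ^+ 2 * N%:R) (b%:R - k%:R + 1 + sig ^+ 2 * N%:R).
  by apply: le_lpp_shape; [exact: addr_ge0 (ltW a0') _|clear -ksb; lra|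
    clear -t2 ck cN sigN; lra|clear -k2 cN c0 sigN; lra].
by clear -t1 le1 pert errE; lra.
Qed.

End boundary_limit.

(** * The limit shape *)

Section limit_shape.
Variable R : realType.

(** A linear form that occurs is never below [lpp_shape], so a single linear half is the maximum.
    Two linear halves are compared through the factorization [diff], which is where the threshold
    [t * s] comes from. *)
Lemma limit_shapeE (lam rho : R) (a b : nat) : 0 < lam <= 1 -> 0 <= rho < 1 ->
  (0 < a)%N -> (0 < b)%N -> limit_shape lam rho (a%:Z, b%:Z) =
  Num.max (half_shape lam a%:R b%:R) (half_shape (1 - rho) b%:R a%:R).
Proof.
move=> /andP[l0 l1] /andP[r0 r1] a0' b0'.
rewrite /limit_shape /= -!pmulrn.
have : 0 < a%:R :> R by rewrite ltr0n.
have : 0 < b%:R :> R by rewrite ltr0n.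
move: (a%:R : R) (b%:R : R) => {a0' b0'}a {}b b0 a0.
have r1' : 0 < 1 - rho by rewrite subr_gt0.
set q := b / a; have q0 : 0 < q by exact: divr_gt0.
have bE : b = q * a by rewrite /q divfK// gt_eqF.
pose s := rho / (1 - rho); have s0 : 0 <= s by rewrite divr_ge0// ltW.
have -> : odds rho = s%:E by rewrite /odds lt_eqF.
rewrite -[in X in Num.max _ X]/(half_shape _ _ _) /half_shape subKr.
have -> : (a * rho ^+ 2 <= b * (1 - rho) ^+ 2) = (s ^+ 2 <= q).
  rewrite /s expr_div_n ler_pdivrMr ?exprn_gt0// bE mulrAC.
  by rewrite [a * _]mulrC ler_pM2r.
rewrite [lpp_shape b a]lpp_shapeC -/(lpp_shape a b).
set LA := a / (1 - lam) + b / lam; rewrite [b / rho + _]addrC.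
set LB := a / (1 - rho) + b / rho.
have leLB : q < s * s -> lpp_shape a b <= LB.
  move=> qs; apply: lpp_shape_le_linear; rewrite ?ltW ?r1 ?andbT//.
  rewrite lt_neqAle r0 andbT.
  apply/eqP => rE; move: qs; rewrite /s -rE mul0r mulr0.
  by move=> /(lt_trans q0); rewrite ltxx.
rewrite [s ^+ 2]expr2 -EFinM.
(* At [lam = 1] the first half is always [lpp_shape]; the product of thresholds is infinite when
   [q < s * s], since then [s > 0]. *)
move: l1; rewrite le_eqVlt => /orP[/eqP lamE|l1].
  rewrite lamE subrr expr0n expr1n mulr0 mulr1 (ltW a0) /odds eqxx mulyy leey andbT.
  rewrite lee_fin; case: (lerP (s * s) q) => [|qs]; first by rewrite maxxx.
  have sp : 0 < s.
    rewrite lt_neqAle s0 andbT; apply/eqP => sE; move: qs.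
    by rewrite -sE mul0r => /(lt_trans q0); rewrite ltxx.
  rewrite gt0_mulye ?lte_fin// maxxx leye_eq /= minEle leey lee_fin (ltW qs).
  by rewrite max_r// leLB.
have l1' : 0 < 1 - lam by rewrite subr_gt0.
pose t := lam / (1 - lam); have t0 : 0 < t by rewrite divr_gt0.
have -> : odds lam = t%:E by rewrite /odds lt_eqF.
have -> : (b * (1 - lam) ^+ 2 <= a * lam ^+ 2) = (q <= t * t).
  rewrite -expr2 /t expr_div_n ler_pdivlMr ?exprn_gt0// bE mulrAC.
  by rewrite [a * _]mulrC ler_pM2r.
rewrite -!EFinM -EFin_max -EFin_min !lee_fin ge_max le_min.
have leLA : lpp_shape a b <= LA by apply: lpp_shape_le_linear; rewrite ?l0 ?ltW.
case: (lerP (s * s) q) => qs; case: (lerP q (t * t)) => qt /=.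
- by rewrite maxxx.
- rewrite (ltW qt) (_ : t * s <= q) ?max_l//.
  by have := sqr_ge0 (t - s); rewrite expr2; lra.
- have ts : q <= t * s.
    have ts0 : 0 <= t * s by rewrite mulr_ge0// ltW.
    rewrite -ler_sqr ?nnegrE ?(ltW q0)// !expr2 [leRHS]mulrACA.
    exact: (ler_pM (ltW q0) (ltW q0) qt (ltW qs)).
  rewrite (ltW qs) ts (_ : _ && _ = false) ?max_r ?leLB//=.
  (* The second test of [limit_shape] would force [t = s], and then [t * t <= q < s * s] is
     absurd. *)
  apply/negbTE/negP => /andP[tq tsq].
  have tE : t * t = t * s by lra.
  have st : s = t by apply: (mulfI (lt0r_neq0 t0)); rewrite tE.
  by move: qs; rewrite st; lra.
rewrite (ltW qt) (ltW qs) /=.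
have ts : t < s.
  by rewrite -ltr_sqr ?nnegrE ?(ltW t0)// !expr2; exact: lt_trans qs.
have sp : 0 < s by exact: lt_trans ts.
have diff : LA - LB = a * ((s - t) * (q - t * s) / (t * s)).
  have rp : 0 < rho by move: sp; rewrite /s pmulr_lgt0 ?invr_gt0.
  by rewrite /LA /LB bE /t /s; field; rewrite !gt_eqF.
case: (lerP (t * s) q) => tsq /=.
  rewrite max_l// -subr_ge0 diff; apply: mulr_ge0; first exact: ltW.
  by rewrite divr_ge0// mulr_ge0 ?subr_ge0// ltW.
rewrite (ltW tsq) max_r// -subr_le0 diff.
apply: mulr_ge0_le0; first exact: ltW.
apply: mulr_le0_ge0; last by rewrite invr_ge0 mulr_ge0// ltW.
by rewrite mulr_ge0_le0 ?subr_ge0 ?subr_le0// ltW.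
Qed.

End limit_shape.

(** * Transfer to [lppG] and the almost sure limit *)

Section main.
Variable R : realType.
Implicit Types x : int * int -> R.

Lemma sup_near (I : Type) (D : set I) (f : I -> R) (v e : R) :
  (forall i, D i -> f i <= v + e) -> (exists2 i, D i & v - e <= f i) ->
  `|sup [set f i | i in D] - v| <= e.
Proof.
move=> ub [i Di lb]; have ubS : ubound [set f i | i in D] (v + e).
  by move=> _ [j Dj <-]; exact: ub.
rewrite ler_distl; apply/andP; split.
  by apply: (le_trans lb); apply: ub_le_sup; [exists (v + e)|exists i].
by apply: ge_sup => //; exists (f i); exists i.
Qed.

Lemma max_near (a b a' b' e : R) : `|a - a'| <= e -> `|b - b'| <= e ->
  `|Num.max a b - Num.max a' b'| <= e.
Proof.
rewrite !ler_distl => /andP[? ?] /andP[? ?]; apply/andP; split.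
  by rewrite lerBlDr addr_maxl ge_max !le_max; apply/andP; split; apply/orP;
     [left|right]; lra.
by rewrite ge_max addr_maxl !le_max; apply/andP; split; apply/orP;
   [left|right]; lra.
Qed.

Lemma passage_shape_limit x : (forall z, 0 <= x z) ->
  (forall M i, (0 < i < M)%N -> stationary_limit x (i%:R / M%:R)) ->
  shape_limit (passage x).
Proof.
move=> x0 xlim eps eps0; pose e := Num.min eps 1.
have e01 : 0 < e <= 1 by rewrite /e lt_min eps0 ltr01 ge_min lexx orbT.
have e_eps : e <= eps by rewrite /e ge_min lexx.
have [N1 h1] := passage_lower x0 xlim e01.
have [N2 h2] := passage_upper x0 xlim eps0.
exists (maxn N1 N2) => N; rewrite geq_max => /andP[N1N N2N] z z1 z2 i j iN jN.
rewrite ler_distl (h2 N N2N z z1 z2 i j iN jN) andbT lerBlDr.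
apply: (le_trans (h1 N N1N z z1 z2 i j iN jN)).
by rewrite lerD2l ler_wpM2r.
Qed.

Lemma shape_limit_swap (T : int * int -> nat -> nat -> R) : shape_limit T ->
  shape_limit (fun z i j => T (z.2, z.1) j i).
Proof.
move=> h eps eps0; have [N0 hN] := h eps eps0; exists N0 => N N0N z z1 z2 i j iN jN.
by rewrite lpp_shapeC; exact: hN.
Qed.

Lemma lppG_limit x (alpha beta : nat -> int) (lam rho : R) :
  shape_limit (passage x) ->
  (forall k, (0 < k)%N -> alpha k < 0) -> (forall m, (0 < m)%N -> beta m < 0) ->
  0 < lam <= 1 -> 0 <= rho < 1 ->
  (fun k : nat => (alpha k)%:~R / k%:R : R) @ \oo --> - ((1 - lam) / lam) ->
  (fun m : nat => (beta m)%:~R / m%:R : R) @ \oo --> - (rho / (1 - rho)) ->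
  (fun z : int * int => (lppG alpha beta x z - limit_shape lam rho z)
     / (l1norm z)%:~R) @ quadrant_infty --> (0 : R).
Proof.
move=> shp a0 b0 l01 r01 alim blim.
apply/cvgrPdist_le => eps eps0; pose e := Num.min eps 1.
have e01 : 0 < e <= 1 by rewrite /e lt_min eps0 ltr01 ge_min lexx orbT.
have e_eps : e <= eps by rewrite /e ge_min lexx.
have r01' : 0 < 1 - rho <= 1 by case/andP: r01 => ? ?; apply/andP; split; lra.
have blim' : (fun m : nat => (beta m)%:~R / m%:R : R) @ \oo -->
    - ((1 - (1 - rho)) / (1 - rho)) by rewrite subKr.
have [NA hA] := boundary_limit shp l01 a0 alim e01.
have [NB hB] := boundary_limit (shape_limit_swap shp) r01' b0 blim' e01.
exists (maxn NA NB) => // -[z1 z2] /= [].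
case: z1 => // a; case: z2 => // b; rewrite !ltz_nat /l1norm /= => apos bpos.
rewrite -PoszD lez_nat geq_max => /andP[NAab NBab].
have [uA lA] := hA a b apos bpos NAab.
have [uB lB] := hB b a bpos apos (leq_trans NBab (eq_leq (addnC a b))).
rewrite [(b + a)%N]addnC in uB lB.
rewrite limit_shapeE//.
have N0 : 0 < (a + b)%:R :> R by rewrite ltr0n addn_gt0 apos.
rewrite sub0r normrN normf_div -pmulrn (gtr0_norm N0) ler_pdivrMr//.
have lppA k : (0 < k <= b)%N -> lpp x (ptA alpha k) (a%:Z, b%:Z) =
    passage x (ptA alpha k) (a + absz (alpha k)).-1 (b - k).
  move=> /andP[k0 kb]; rewrite /passage -lpp_growth; congr lpp.
  have := a0 k k0; clear -apos kb; rewrite /site /ptA /= => ak.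
  by congr (_, _); lia.
have lppB m : (0 < m <= a)%N -> lpp x (ptB beta m) (a%:Z, b%:Z) =
    passage x (ptB beta m) (a - m) (b + absz (beta m)).-1.
  move=> /andP[m0 ma]; rewrite /passage -lpp_growth; congr lpp.
  have := b0 m m0; clear -bpos ma; rewrite /site /ptB /= => bm.
  by congr (_, _); lia.
suff : `|lppG alpha beta x (a%:Z, b%:Z) -
    Num.max (half_shape lam a%:R b%:R) (half_shape (1 - rho) b%:R a%:R)| <=
    e * (a + b)%:R.
  by move=> /le_trans; apply; rewrite ler_wpM2r// ltW.
apply: max_near; apply: sup_near => /=.
- move=> k [k0 kb]; have k01 : (0 < k <= b)%N by rewrite k0 -lez_nat.
  by rewrite lppA// uA.
- have [k k01 lk] := lA; exists k; first by move: k01; rewrite -lez_nat => /andP.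
  by rewrite lppA.
- move=> m [m0 ma]; have m01 : (0 < m <= a)%N by rewrite m0 -lez_nat.
  by rewrite lppB// uB.
- have [m m01 lm] := lB; exists m; first by move: m01; rewrite -lez_nat => /andP.
  by rewrite lppB.
Qed.

End main.

(** The tolerance runs through the values [3 / (j + 1)], so the exceptional sets form a countable
    family. *)
Lemma stationary_limit_ae (d : measure_display) (Omega : measurableType d)
    (R : realType) (P : probability Omega R)
    (X : (int * int)%type -> {RV P >-> R}) (rho : R) :
  iid_exponential1 X -> 0 < rho < 1 ->
  {ae P, forall w, stationary_limit (fun z => X z w) rho}.
Proof.
move=> iidX rho01.
have H j : {ae P, forall w, exists N0 : nat, forall N, (N0 <= N)%N ->
    forall u, `|u.1| <= N%:Z -> `|u.2| <= N%:Z ->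
    forall m n, (m <= N)%N -> (n <= N)%N ->
    `|growth (stationary rho (fun z => X z w) u) m n -
       (m%:R / (1 - rho) + n%:R / rho)| <= 3 * j.+1%:R^-1 * N%:R}.
  apply: stationary_ae => //.
  by rewrite invr_gt0 ltr0n invf_le1 ?ltr0n// (ler_nat R 1).
have := ae_foralln H; apply: filterS => w Hw eps eps0.
pose j := Num.truncn (3 / eps).
have jeps : 3 * j.+1%:R^-1 <= eps.
  rewrite ler_pdivrMr ?ltr0n// mulrC -ler_pdivrMr// ltW//; exact: truncnS_gt.
have [N0 hN] := Hw j; exists N0 => N N0N u u1 u2 m n mN nN.
by apply: (le_trans (hN N N0N u u1 u2 m n mN nN)); rewrite ler_wpM2r.
Qed.

Lemma nonincreasing_neg (alpha : nat -> int) : alpha 1%N < 0 ->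
  (forall k, (0 < k)%N -> alpha k.+1 <= alpha k) ->
  forall k, (0 < k)%N -> alpha k < 0.
Proof.
move=> a1 ani; elim=> // -[|k] IH _ //.
exact: le_lt_trans (ani k.+1 isT) (IH isT).
Qed.

Theorem proposition2p1 (d : measure_display) (Omega : measurableType d)
    (R : realType) (P : probability Omega R)
    (X : (int * int)%type -> {RV P >-> R}) (iidX : iid_exponential1 X)
    (alpha beta : nat -> int)
    (alpha1 : alpha 1%N < 0)
    (alpha_ni : forall k, (0 < k)%N -> alpha k.+1 <= alpha k)
    (beta1 : beta 1%N < 0)
    (beta_ni : forall m, (0 < m)%N -> beta m.+1 <= beta m)
    (lam rho : R)
    (lam_itv : 0 < lam <= 1) (rho_itv : 0 <= rho < 1)
    (alpha_lim :
      (fun k : nat => (alpha k)%:~R / k%:R : R) @ \oo --> - ((1 - lam) / lam))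
    (beta_lim :
      (fun m : nat => (beta m)%:~R / m%:R : R) @ \oo --> - (rho / (1 - rho))) :
  {ae P, forall w,
    (fun z : int * int =>
       (lppG alpha beta (fun y => X y w) z - limit_shape lam rho z)
       / (l1norm z)%:~R) @ quadrant_infty --> (0 : R)}.
Proof.
(* With rates of the form [i / M] only, one null set serves all of them. *)
have rate_ae (M i : nat) : {ae P, forall w, (0 < i < M)%N ->
    stationary_limit (fun z => X z w) (i%:R / M%:R)}.
  case: (boolP (0 < i < M)%N) => [iM|_]; last exact: aeW.
  have := stationary_limit_ae iidX (natr_ratio_itv R iM).
  by apply: filterS => w h _.
have rates_ae := ae_foralln (fun M => ae_foralln (rate_ae M)).
apply: filterS2 (ae_exponential_ge0 iidX) rates_ae => w X0 Xlim.
apply: lppG_limit => //.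
- exact: passage_shape_limit.
- exact: nonincreasing_neg.
- exact: nonincreasing_neg.
Qed.
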